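(* Let $G$ be a non-compact locally compact group with compact covering number $\eta$. Then the group algebra $L^1(G)$ has an $F\ell^1(\eta)$-base of type 2.
   Context: The compact covering number of $G$ is the least cardinality of a covering of $G$ by compact sets. $L^1(G)$ is the convolution algebra with respect to a fixed left Haar measure; it has a bounded approximate identity. For a Banach algebra $A$, $M_r(A)$ is the algebra of bounded operators $R$ on $A$ with $R(ab)=aR(b)$, with product $R_1R_2=R_2\circ R_1$; for $a\in A$, $R\in M_r(A)$ one writes $aR=R(a)\in A$. For $A=L^1(G)$, $M_r(A)=M(G)$ (Wendel), acting by right convolution. $\langle E\rangle$ denotes linear span; cardinals are identified with initial ordinals. $F\ell^1(\eta)$-base of type 2 in a Banach algebra $A$ with a bounded approximate identity: a set $\mathscr L=\bigcup_{\alpha<\eta}A_\alpha a_\alpha$ such that (i) $\{A_\alpha\}_{\alpha<\eta}$ is an increasing family of subsets of $A$ with $A_\eta=\bigcup_{\alpha<\eta}A_\alpha$ bounded (by $1$, say) and with closed linear span equal to $A$; (ii) $\{a_\alpha:\alpha<\eta\}$ is a bounded subset of $M_r(A)$; (iii) the spans $\langle A_\alpha a_\alpha\rangle$, $\alpha<\eta$, have zero pairwise intersections; (iv) for some $K_1>0$, $\sum_{n=1}^p\|x_n\|\le K_1\|\sum_{n=1}^px_n\|$ whenever $p\in\mathbb N$, $x_n\in\langle A_{\alpha_n}a_{\alpha_n}\rangle$ and $\alpha_1,\dots,\alpha_p<\eta$ are distinct; (v) for some $K_2>0$, $\|a\|\le K_2\|aa_\alpha\|$ for every $a\in\langle A_\alpha\rangle$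 and $\alpha<\eta$. *)

(* Defs.v *)
From HB Require Import structures.
From mathcomp Require Import all_boot all_order all_algebra.
From mathcomp Require Import generic_quotient ring_quotient.
From mathcomp Require Import complex.
From mathcomp Require Import all_classical all_reals all_analysis.
From mathcomp Require Import measurable_realfun.

Set Implicit Arguments.
Unset Strict Implicit.
Unset Printing Implicit Defensive.

Import Order.TTheory GRing.Theory Num.Theory.
Import numFieldTopology.Exports numFieldNormedType.Exports.
Import Normc.

Local Open Scope classical_set_scope.
Local Open Scope complex_scope.
Local Open Scope card_scope.
Local Open Scope ring_scope.

Section ComplexL1.
Context d (T : measurableType d) (R : realType).
Variable mu : {measure set T -> \bar R}.

Definition cintegrable (f : T -> R[i]^o) : Prop :=
  mu.-integrable setT (EFin \o (fun x => complex.Re (f x))) /\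
  mu.-integrable setT (EFin \o (fun x => complex.Im (f x))).

Definition cintegral (f : T -> R[i]^o) : R[i] :=
  (\int[mu]_x complex.Re (f x)) +i* (\int[mu]_x complex.Im (f x)).

Definition l1fun_pred : {pred T -> R[i]^o} := fun f => `[< cintegrable f >].

Lemma l1fun_submod_closed : submod_closed l1fun_pred.
Proof.
split=> [|a f g].
  by apply/asboolP; split; exact: integrable0.
move=> /asboolP[fr fi] /asboolP[gr gi]; apply/asboolP; split.
- have h := integrableD measurableT (integrableB measurableT
    (integrableZl measurableT (complex.Re a) fr)
    (integrableZl measurableT (complex.Im a) fi)) gr.
  apply: eq_integrable h => // x _ /=.
  rewrite -!EFinM -EFinB -EFinD; congr EFin.
  rewrite !fctE; case: (f x) (g x) a => [u v] [w z] [s t].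
  by [].
- have h := integrableD measurableT (integrableD measurableT
    (integrableZl measurableT (complex.Re a) fi)
    (integrableZl measurableT (complex.Im a) fr)) gi.
  apply: eq_integrable h => // x _ /=.
  rewrite -!EFinM -!EFinD; congr EFin.
  rewrite !fctE; case: (f x) (g x) a => [u v] [w z] [s t].
  by [].
Qed.
HB.instance Definition _ :=
  GRing.isSubmodClosed.Build R[i] (T -> R[i]^o) l1fun_pred l1fun_submod_closed.

Record l1fun := L1fun {
  l1fun_val :> T -> R[i]^o ;
  _ : l1fun_val \in l1fun_pred }.
HB.instance Definition _ := [isSub for l1fun_val].
HB.instance Definition _ := [Choice of l1fun by <:].
HB.instance Definition _ := [SubChoice_isSubLmodule of l1fun by <:].

Lemma l1funP (f : l1fun) : cintegrable f.
Proof. by case: f => f /= /asboolP. Qed.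

Definition l1null : {pred l1fun} := fun f => `[< \forall x \ae mu, f x = 0 >].

Lemma l1null_submod_closed : submod_closed l1null.
Proof.
split=> [|a f g]; first by apply/asboolP; exact: aeW.
move=> /asboolP f0 /asboolP g0; apply/asboolP.
by apply: filterS2 f0 g0 => x /= fx gx; rewrite !fctE fx gx scaler0 addr0.
Qed.
HB.instance Definition _ :=
  GRing.isSubmodClosed.Build R[i] l1fun l1null l1null_submod_closed.

Definition L1 : Type := Quotient.quot l1null.
HB.instance Definition _ := Choice.on L1.
HB.instance Definition _ := GRing.Zmodule.on L1.
HB.instance Definition _ := EqQuotient.on L1.
HB.instance Definition _ := ZmodQuotient.on L1.

Local Open Scope quotient_scope.

Lemma L1_eqP (f g : l1fun) :
  \pi_L1 f = \pi_L1 g <-> \forall x \ae mu, f x = g x.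
Proof.
have -> : (\pi_L1 f = \pi_L1 g) <-> (f - g \in l1null).
  by rewrite Quotient.idealrBE; split=> /eqP.
split=> [/asboolP|] h; last apply/asboolP; apply: filterS h => x /=.
  by rewrite !fctE => /eqP; rewrite subr_eq0 => /eqP.
by rewrite !fctE => ->; rewrite subrr.
Qed.

Lemma repr_piE (f : l1fun) : \forall x \ae mu, repr (\pi_L1 f) x = f x.
Proof. by apply/L1_eqP; rewrite reprK. Qed.

Lemma L1_piD (f g : l1fun) : \pi_L1 (f + g) = \pi_L1 f + \pi_L1 g.
Proof. by rewrite pi_addr. Qed.

Definition L1_scale (a : R[i]) (f : L1) : L1 := \pi_L1 (a *: repr f).

Lemma L1_scale_pi a (f : l1fun) : L1_scale a (\pi_L1 f) = \pi_L1 (a *: f).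
Proof.
apply/L1_eqP; apply: filterS (repr_piE f) => x /=.
by rewrite !fctE => ->.
Qed.

Lemma L1_scaleA a b f : L1_scale a (L1_scale b f) = L1_scale (a * b) f.
Proof. by rewrite -[f]reprK (L1_scale_pi b) !L1_scale_pi scalerA. Qed.

Lemma L1_scale1 : left_id 1 L1_scale.
Proof. by move=> f; rewrite -[f]reprK L1_scale_pi scale1r. Qed.

Lemma L1_scaleDr : right_distributive L1_scale +%R.
Proof.
move=> a f g; rewrite -[f]reprK -[g]reprK -L1_piD !L1_scale_pi.
by rewrite scalerDr L1_piD.
Qed.

Lemma L1_scaleDl f : {morph L1_scale^~ f : a b / a + b}.
Proof.
move=> a b; rewrite -[f]reprK !L1_scale_pi.
by rewrite scalerDl L1_piD.
Qed.

HB.instance Definition _ := GRing.Zmodule_isLmodule.Build R[i] L1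
  L1_scaleA L1_scale1 L1_scaleDr L1_scaleDl.

Lemma normc_ge0 (z : R[i]) : 0 <= normc z.
Proof. by case: z => a b /=; exact: sqrtr_ge0. Qed.

Lemma normc_le (z : R[i]) : normc z <= `|complex.Re z| + `|complex.Im z|.
Proof.
case: z => a b /=; rewrite -[leRHS]ger0_norm ?addr_ge0//.
rewrite -[leRHS]sqrtr_sqr ler_wsqrtr// sqrrD -!normrX.
rewrite [`|a ^+ 2|]ger0_norm ?sqr_ge0// [`|b ^+ 2|]ger0_norm ?sqr_ge0//.
by rewrite addrAC lerDl mulrn_wge0// mulr_ge0.
Qed.

Lemma measurable_normc (f : T -> R[i]^o) :
  measurable_fun setT (fun x => complex.Re (f x)) ->
  measurable_fun setT (fun x => complex.Im (f x)) ->
  measurable_fun setT (fun x => normc (f x)).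
Proof.
move=> fr fi.
rewrite (_ : (fun x => _) = Num.sqrt \o
  (fun x => complex.Re (f x) ^+ 2 + complex.Im (f x) ^+ 2)); last first.
  by apply/funext => x /=; case: (f x).
apply: measurableT_comp.
  by apply: continuous_measurable_fun; exact: sqrt_continuous.
by apply: measurable_funD; exact: measurable_funX.
Qed.

Lemma integrable_normc (f : T -> R[i]^o) : cintegrable f ->
  mu.-integrable setT (EFin \o (fun x => normc (f x))).
Proof.
move=> [fr fi].
have h := integrableD measurableT (integrable_norm fr) (integrable_norm fi).
apply: le_integrable h => //.
- apply/measurable_EFinP/measurable_normc; apply/measurable_EFinP.
    exact: measurable_int fr.
  exact: measurable_int fi.
- move=> x _ /=; rewrite lee_fin ger0_norm ?normc_ge0//.
  by rewrite ger0_norm ?addr_ge0//; exact: normc_le.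
Qed.

Definition L1_norm (f : L1) : R[i] := (\int[mu]_x normc (repr f x))%:C.

Lemma L1_norm_pi (f : l1fun) :
  L1_norm (\pi_L1 f) = (\int[mu]_x normc (f x))%:C.
Proof.
congr (_ %:C); congr fine; apply: ae_eq_integral => //.
- exact: measurable_int (integrable_normc (l1funP _)).
- exact: measurable_int (integrable_normc (l1funP _)).
- by apply: filterS (repr_piE f) => x -> _.
Qed.

Lemma L1_normD f g : L1_norm (f + g) <= L1_norm f + L1_norm g.
Proof.
rewrite -[f]reprK -[g]reprK -L1_piD !L1_norm_pi -rmorphD lecR.
rewrite -RintegralD//; try exact: integrable_normc (l1funP _).
apply: le_Rintegral => //; try exact: integrable_normc (l1funP _).
  have := integrableD measurableT (integrable_normc (l1funP (repr f)))
    (integrable_normc (l1funP (repr g))).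
  by apply: eq_integrable.
by move=> x _; rewrite -lecR rmorphD; exact: lec_normD.
Qed.

Lemma L1_normZ a f : L1_norm (a *: f) = `|a| * L1_norm f.
Proof.
rewrite -[f]reprK [_ *: _]L1_scale_pi !L1_norm_pi.
have -> : `|a| = (normc a)%:C by [].
rewrite -rmorphM -RintegralZl//; last exact: integrable_normc (l1funP _).
congr (_ %:C); apply: eq_Rintegral => x _.
by rewrite -normcM.
Qed.

Lemma L1_norm0 f : L1_norm f = 0 -> f = 0.
Proof.
rewrite -[f]reprK L1_norm_pi => -[] h.
have [h1 h2] := l1funP (repr f).
have mf := measurable_int mu (integrable_normc (l1funP (repr f))).
have h0 : (\int[mu]_x `|(normc (repr f x))%:E| = 0)%E.
  rewrite -[RHS]/(0%:E) -h /Rintegral.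
  under eq_integral do rewrite gee0_abs ?lee_fin ?normc_ge0//.
  rewrite fineK//; apply: integrable_fin_num => //.
  exact: integrable_normc (l1funP _).
have := (ae_eq_integral_abs mu measurableT mf).1 h0.
move=> ae0; rewrite -[0]reprK; apply/L1_eqP.
have r0 : \forall x \ae mu, repr (0 : L1) x = 0.
  have -> : (0 : L1) = \pi_L1 0 by rewrite pi_zeror.
  by apply: filterS (repr_piE 0) => x ->.
apply: filterS2 ae0 r0 => x /= /(_ I) [] /eq0_normc -> ->.
by [].
Qed.

HB.instance Definition _ :=
  Lmodule_isNormed.Build R[i] L1 L1_normD L1_normZ L1_norm0.

End ComplexL1.

HB.mixin Record isTopologicalGroup G of PointedTopological G & Group G := {
  mulg_continuous : continuous (fun p : G * G => (p.1 * p.2)%g) ;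
  invg_continuous : continuous (fun x : G => x^-1%g) }.

(* The designated point of [PointedTopological] is only there because the
   library generates sigma-algebras on pointed types. *)
#[short(type="topologicalGroupType")]
HB.structure Definition TopologicalGroup :=
  {G of PointedTopological G & Group G & isTopologicalGroup G}.

Notation borelType G := (g_sigma_algebraType (@open G)).

Section HaarMeasure.
Context (R : realType) (G : topologicalGroupType).
Variable mu : {measure set (borelType G) -> \bar R}.
Local Open Scope ereal_scope.

Definition radon_measure : Prop :=
  [/\ forall K : set G, compact K -> mu K < +oo,
      forall B : set (borelType G), measurable B ->
        mu B = ereal_inf [set mu U | U in [set U : set G | open U /\ B `<=` U]]
    & forall U : set G, open U ->
        mu U = ereal_sup [set mu K | K in [set K : set G | compact K /\ K `<=` U]]].

Definition left_haar_measure : Prop :=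
  [/\ radon_measure,
      mu setT != 0
    & forall (g : G) (B : set (borelType G)), measurable B ->
        mu [set (g * x)%g | x in (B : set G)] = mu B].

End HaarMeasure.

Section Convolution.
Context (R : realType) (G : topologicalGroupType).
Variable mu : {measure set (borelType G) -> \bar R}.
Local Open Scope quotient_scope.

Definition convolution_fun (f g : G -> R[i]) : borelType G -> R[i]^o :=
  fun x => cintegral mu (fun y : borelType G => f y * g ((y : G)^-1 * x)%g).

(* [insubd 0] only makes the definition total: when [mu] is a left Haar measure
   the convolution of two integrable functions is integrable and, up to a null
   set, depends only on their classes. [cintegral] takes arbitrary values on the
   null set where the integral does not converge absolutely. *)
Definition L1_convolution (f g : L1 mu) : L1 mu :=
  \pi_(L1 mu) (insubd (0 : l1fun mu) (convolution_fun (repr f) (repr g))).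

End Convolution.

Section CompactCoveringNumber.
Context (G : topologicalType).

Definition compact_covering (C : set (set G)) : Prop :=
  (forall K, C K -> compact K) /\ \bigcup_(K in C) K = [set: G].

Definition is_compact_covering_number (eta : Type) : Prop :=
  (exists C, compact_covering C /\ C #= [set: eta]) /\
  (forall C, compact_covering C -> [set: eta] #<= C).

End CompactCoveringNumber.

(* The elements of [eta] are the ordinals smaller than a cardinal, i.e. the
   order type of [eta] is an initial ordinal. *)
Definition initial_ordinal d (eta : orderType d) : Prop :=
  well_founded (fun i j : eta => (i < j)%O) /\
  forall i : eta, ~ ([set: eta] #<= [set j : eta | (j < i)%O]).

Section Fl1Base.
Context (K : numFieldType) (A : normedModType K) (mul : A -> A -> A).

Definition lin_span (E : set A) : set A :=
  [set x | exists (n : nat) (c : 'I_n -> K) (e : 'I_n -> A),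
    (forall i, E (e i)) /\ x = \sum_(i < n) c i *: e i].

Record right_multiplier := RightMultiplier {
  rmult_fun :> {linear A -> A} ;
  rmult_bounded : exists M : K, forall x, `|rmult_fun x| <= M * `|x| ;
  rmult_mul : forall a b, rmult_fun (mul a b) = mul a (rmult_fun b) }.

Context d (eta : orderType d).

(* The algebra axioms, completeness and the bounded approximate identity of [A]
   occur in none of the clauses. The action [a * R] of a right multiplier [R] on
   [a] is [R a]. *)
Record fl1_base2_data (A_ : eta -> set A) (a_ : eta -> right_multiplier)
    (L : set A) : Prop := {
  fl1_base2E : L = \bigcup_i (a_ i @` A_ i) ;
  fl1_base2_mono : forall i j, (i <= j)%O -> A_ i `<=` A_ j ;
  fl1_base2_bounded : forall x, (\bigcup_i A_ i) x -> `|x| <= 1 ;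
  fl1_base2_dense : closure (lin_span (\bigcup_i A_ i)) = setT ;
  fl1_base2_mult_bounded : exists M : K, forall i x, `|a_ i x| <= M * `|x| ;
  fl1_base2_disjoint : forall i j, i != j ->
    lin_span (a_ i @` A_ i) `&` lin_span (a_ j @` A_ j) = [set 0] ;
  fl1_base2_l1 : exists2 K1 : K, 0 < K1 &
    forall (p : nat) (alpha : 'I_p -> eta) (x : 'I_p -> A),
      injective alpha ->
      (forall n, lin_span (a_ (alpha n) @` A_ (alpha n)) (x n)) ->
      \sum_(n < p) `|x n| <= K1 * `|\sum_(n < p) x n| ;
  fl1_base2_below : exists2 K2 : K, 0 < K2 &
    forall i a, lin_span (A_ i) a -> `|a| <= K2 * `|a_ i a| }.

Definition fl1_base_type2 (L : set A) : Prop :=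
  exists A_ a_, fl1_base2_data A_ a_ L.

End Fl1Base.

(* Main.v *)
(* Compact sets C_i (i < eta) are chosen so that every compact set lies in a
   finite union of them. A product of three copies of a proper initial segment
   of eta has fewer than eta elements, so the sets C_i^-1 C_j x_b (b < a, i <=
   a, j <= b) do not cover G and points x_a can be chosen by transfinite
   recursion with C_i x_a and C_j x_b disjoint. Taking for A_a the functions of
   norm at most 1 carried by finitely many C_i, i <= a, and for a_a the
   normalised right translation by x_a, the spans of the A_a a_a have disjoint
   supports.

   Right translations are isometric up to a constant by uniqueness of the Haar
   measure, and commute with left convolution operators on classes because
   inversion preserves null sets locally. As the product sigma-algebra of G * G
   is in general smaller than its Borel sigma-algebra, Fubini's theorem is
   avoided in both: mu(V^-1) nu(A) and mu(K) nu(V) are bounded by cutting a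
   compact set into finitely many small Borel pieces. *)

Require Import Defs.
From HB Require Import structures.
From mathcomp Require Import all_boot all_order all_algebra.
From mathcomp Require Import generic_quotient ring_quotient.
From mathcomp Require Import finmap complex.
From mathcomp Require Import all_classical all_reals all_analysis.
From mathcomp Require Import measurable_realfun.

Set Implicit Arguments.
Unset Strict Implicit.
Unset Printing Implicit Defensive.

Import Order.TTheory GRing.Theory Num.Theory.
Import numFieldTopology.Exports numFieldNormedType.Exports.
Import Normc.

Local Open Scope classical_set_scope.
Local Open Scope complex_scope.
Local Open Scope card_scope.
Local Open Scope quotient_scope.
Local Open Scope ring_scope.

(** * Transfinite recursion and cardinal arithmetic *)

Lemma wf_choice (I X : Type) (lt : I -> I -> Prop)
    (P : I -> (I -> X) -> X -> Prop) (x0 : X) :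
  well_founded lt ->
  (forall i g g' x, (forall j, lt j i -> g j = g' j) -> P i g x -> P i g' x) ->
  (forall i g, exists x, P i g x) ->
  exists f, forall i, P i f (f i).
Proof.
move=> wf_lt Pext Pex.
(* Values known only below [i] are completed by the default [x0]. By [Pext] the property at [i] does
   not see the completed part, so the default is harmless. *)
pose ext i (r : forall j, lt j i -> X) j :=
  if pselect (lt j i) is left h then r j h else x0.
have /choice[sel selP] : forall ig : I * (I -> X), exists x, P ig.1 ig.2 x.
  by move=> [i g]; exact: Pex.
pose F i (r : forall j, lt j i -> X) := sel (i, ext i r).
pose f := Fix wf_lt (fun=> X) F.
have fE i : f i = F i (fun j _ => f j).
  apply: (Fix_eq wf_lt (fun=> X) F) => j r r' rr'; congr sel; congr pair.
  by apply/funext => k; rewrite /ext; case: pselect.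
exists f => i; rewrite fE /F; apply: Pext (selP (i, _)) => j ji /=.
by rewrite /ext; case: pselect.
Qed.

Lemma card_le_setX T T' U U' (A : set T) (A' : set T') (B : set U)
    (B' : set U') :
  A #<= B -> A' #<= B' -> A `*` A' #<= B `*` B'.
Proof.
move=> /pfcard_geP[->|[f]]; first by rewrite set0X card_ge0.
move=> /pfcard_geP[->|[g]]; first by rewrite setX0 card_ge0.
pose h := fun p : U * U' => (f p.1, g p.2).
apply: card_le_trans (card_image_le h (B `*` B')).
apply: subset_card_le => -[a a'] [/= Aa Aa'].
have [b Bb fb] := 'surj_f Aa; have [b' Bb' gb'] := 'surj_g Aa'.
by exists (b, b') => //; rewrite /h /= fb gb'.
Qed.

(** Hilbert's hotel: along a copy [g] of the naturals inside [A], the map [psi] sends [g 0] to [m]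
    and [g n.+1] to [g n], and fixes everything else, so it maps [A] onto [A] with [m] added. *)
Lemma card_le_setU1 T (A : set T) (m : T) :
  infinite_set A -> A `|` [set m] #<= A.
Proof.
elim/Ppointed: T => T in A m *; first by have /no := m.
move=> /infiniteP Ainf.
have [Am|Am] := pselect (A m).
  by apply: subset_card_le => x [//|->].
have /ppcard_leP/unsquash g := Ainf.
pose psi y := if pselect (range g y) is left e then
  if g^-1%FUN y is n.+1 then g n else m else y.
have gK n : g^-1%FUN (g n) = n by apply: funK; rewrite inE.
apply: card_le_trans (card_image_le psi A).
apply: subset_card_le => y /= [Ay|->]; last first.
  exists (g 0%N); first exact: funS.
  by rewrite /psi; case: pselect => [_|[]]; [rewrite gK|exists 0%N].
have [[n _ <-]|ny] := pselect (range g y); last first.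
  by exists y => //; rewrite /psi; case: pselect.
exists (g n.+1); first exact: funS.
by rewrite /psi; case: pselect => [_|[]]; [rewrite gK|exists n.+1].
Qed.

Section Hessenberg.
Local Open Scope order_scope.
Context d (I : orderType d).

Lemma le_segmentE (a : I) : [set j | j <= a] = [set j | j < a] `|` [set a].
Proof.
apply/seteqP; split=> j /=; rewrite le_eqVlt.
  by move=> /orP[/eqP ->|]; [right|left].
by move=> [->|->]; rewrite ?orbT ?eqxx.
Qed.

Hypothesis wfI : well_founded (fun i j : I => i < j).

(** Gödel's canonical well-order of pairs. Comparing maxima before coordinates confines the
    predecessors of a pair to a square over a segment with a maximum. *)
Let pair_lt (p q : I * I) :=
  Order.max p.1 p.2 < Order.max q.1 q.2 \/
  Order.max p.1 p.2 = Order.max q.1 q.2 /\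
    (p.1 < q.1 \/ p.1 = q.1 /\ p.2 < q.2).

Let wf_pair_lt : well_founded pair_lt.
Proof.
suff h m : forall x y, Order.max x y = m -> Acc pair_lt (x, y).
  by case=> x y; exact: (h _ x y erefl).
elim/(well_founded_ind wfI) : m => m IHm x.
elim/(well_founded_ind wfI) : x => x IHx y.
elim/(well_founded_ind wfI) : y => y IHy mE.
constructor => -[x' y'] [/= lt_m|/= [eq_m [lt_x|[ex lt_y]]]].
- by apply: (IHm _ _ _ _ erefl); rewrite -mE.
- by apply: IHx => //; rewrite eq_m.
- by rewrite ex; apply: IHy => //; rewrite -mE -eq_m ex.
Qed.

Let pair_lt_total p q : p <> q -> pair_lt p q \/ pair_lt q p.
Proof.
case: p q => [x y] [x' y'] pq; rewrite /pair_lt /=.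
case: (ltgtP (Order.max x y) (Order.max x' y')) => [||->].
- by left; left.
- by right; left.
case: (ltgtP x x') => [||ex]; [by auto|by auto|].
case: (ltgtP y y') => [||ey]; [by auto 6|by auto 6|].
by case: pq; rewrite ex ey.
Qed.

Lemma card_le_square_segment (a : I) :
  infinite_set [set j | j < a] ->
  [set j | j < a] `*` [set j | j < a] #<= [set j | j < a].
Proof.
elim/(well_founded_ind wfI) : a => a IH ainf.
set A := [set j | j < a].
(* If [A] embeds into a smaller segment, the bound for that segment carries over to [A]. *)
have [[b ba Ab]|nosmall] := pselect (exists2 b, b < a & A #<= [set j | j < b]).
  have binf : infinite_set [set j | j < b].
    by apply: contra_not ainf; exact: card_le_finite.
  apply: card_le_trans (card_le_setX Ab Ab) _.
  apply: card_le_trans (IH _ ba binf) _.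
  by apply: subset_card_le => j /= /lt_trans; exact.
(* Now [A] is not equipotent to a smaller segment, so the pairs below [p], which
   lie in a square [M * M] with [M] smaller than [A], do not exhaust [A]: an
   injection into [A] can be built along [pair_lt]. *)
pose seg p := [set q | pair_lt q p].
have segA p : (A `*` A) p -> ~ (A #<= seg p).
  case: p => x y [/= xa ya] Aseg.
  set m := Order.max x y; have ma : m < a by rewrite /m gt_max xa.
  pose M := [set j : I | j <= m].
  have segM : seg (x, y) `<=` M `*` M.
    move=> [x' y'] xy'; have : Order.max x' y' <= m.
      by case: xy' => [/ltW//|[/= -> _]].
    by rewrite ge_max => /andP[].
  have AMM := card_le_trans Aseg (subset_card_le segM).
  have ME : M = [set j | j < m] `|` [set m] := le_segmentE m.
  have minf : infinite_set [set j | j < m].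
    move=> mfin; apply: ainf; apply: (card_le_finite AMM).
    by apply: finite_setX; rewrite ME finite_setU.
  have Mm : M #<= [set j | j < m] by rewrite ME; exact: card_le_setU1.
  apply: nosmall; exists m => //.
  apply: card_le_trans AMM _; apply: card_le_trans (card_le_setX Mm Mm) _.
  exact: IH.
(* The guard [(A]*[A) p] lets the recursion run over all pairs; outside the square any value is
   accepted. *)
pose P p (g : I * I -> I) y :=
  (A `*` A) p -> A y /\ forall q, pair_lt q p -> g q <> y.
have [||f fP] := @wf_choice _ I _ P a wf_pair_lt.
- move=> p g g' y gg' Pp /Pp[Ay qy]; split => // q qp.
  by rewrite -gg'//; exact: qy.
- move=> p g; have [Ap|nAp] := pselect ((A `*` A) p); last by exists a.
  suff [y [Ay yg]] : exists y, A y /\ ~ (g @` seg p) y.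
    by exists y => _; split => // q qp gq; apply: yg; exists q.
  apply: contrapT => /forallNP h; apply: (segA _ Ap).
  apply: card_le_trans (card_image_le g (seg p)).
  by apply: subset_card_le => y Ay; apply: contrapT => yg; exact: (h y).
have finj : {in A `*` A &, injective f}.
  move=> p q; rewrite !inE => Ap Aq fpq.
  apply: contrapT => /pair_lt_total[pq|qp].
    by have [_ /(_ _ pq)] := fP _ Aq.
  by have [_ /(_ _ qp)] := fP _ Ap; apply.
have /card_eqPle[_ le1] := inj_card_eq finj.
apply: card_le_trans le1 _.
by apply: subset_card_le => _ [p Ap <-]; have [Afp] := fP _ Ap.
Qed.

End Hessenberg.

(** * Compact sets and neighbourhoods of the identity in a topological group *)

Section GroupTopology.
Variable G : topologicalGroupType.
Implicit Types (K U V W : set G).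

Lemma mul_cvg (I : Type) (H : set_system I) {FH : Filter H} (f g : I -> G)
    (a b : G) :
  f @ H --> a -> g @ H --> b -> (fun i => f i * g i)%g @ H --> (a * b)%g.
Proof.
move=> fa gb.
by apply: (cvg_comp2 fa gb); exact: (mulg_continuous (a, b)).
Qed.

Lemma mulgl_continuous (a : G) : continuous (fun x : G => (a * x)%g).
Proof.
by move=> x; apply: mul_cvg; [exact: cvg_cst|exact: cvg_id].
Qed.

Lemma mulgr_continuous (a : G) : continuous (fun x : G => (x * a)%g).
Proof.
by move=> x; apply: mul_cvg; [exact: cvg_id|exact: cvg_cst].
Qed.

Lemma compact_mul K K' : compact K -> compact K' ->
  compact [set (p.1 * p.2)%g | p in K `*` K'].
Proof.
move=> cK cK'; apply: continuous_compact; last exact: compact_setX.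
by apply: continuous_subspaceT => p; exact: mulg_continuous.
Qed.

Lemma compact_inv K : compact K -> compact [set x^-1%g | x in K].
Proof.
move=> cK; apply: continuous_compact => //.
by apply: continuous_subspaceT => p; exact: invg_continuous.
Qed.

Lemma inv_imageE K : [set x^-1%g | x in K] = (fun x : G => x^-1%g) @^-1` K.
Proof.
apply/seteqP; split=> [_ [x Kx <-]|x Kx] /=; first by rewrite invgK.
by exists (x^-1)%g => //; rewrite invgK.
Qed.

(** A tube lemma: this is the near-covering form of compactness. *)
Lemma near1_compact_sub (I : Type) (F : set_system I) {FF : Filter F}
    (f : I -> G -> G) K U : compact K ->
  (forall x, K x -> \forall x' \near x & i \near F, U (f i x')) ->
  \forall i \near F, forall x, K x -> U (f i x).
Proof. by move=> /compact_near_coveringP cK; exact: cK. Qed.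

Lemma nbhs1_mull_sub K U : compact K -> open U -> K `<=` U ->
  \forall w \near (1%g : G), forall x, K x -> U (w * x)%g.
Proof.
move=> cK oU KU; apply: near1_compact_sub => // x Kx.
have : (fun p : G * G => (p.2 * p.1)%g) @ (x, 1%g) --> (1 * x)%g.
  by apply: mul_cvg; [exact: cvg_snd|exact: cvg_fst].
by apply; rewrite mul1g; apply: open_nbhs_nbhs; split => //; exact: KU.
Qed.

(** The map [phi] is left general so as to treat both [w^-1 w'] and [w w'], the two words that occur
    in the comparison of Haar measures. *)
Lemma nbhs1_mulr2_sub (phi : G * G -> G) K U :
  phi @ nbhs (1%g, 1%g) --> (1%g : G) -> compact K -> open U -> K `<=` U ->
  exists2 W : set G, nbhs 1%g W &
    forall x w w', K x -> W w -> W w' -> U (x * phi (w, w'))%g.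
Proof.
move=> cphi cK oU KU.
have [[W W'] /= [W1 W'1] WU] : \forall p \near ((1%g, 1%g) : G * G),
    forall x, K x -> U (x * phi p)%g.
  apply: (@near1_compact_sub _ (nbhs ((1, 1)%g : G * G)) _
    (fun p x => x * phi p)%g) => // x Kx.
  have : (fun p : G * (G * G) => (p.1 * phi p.2)%g) @ (x, (1%g, 1%g))
      --> (x * 1)%g.
    apply: mul_cvg; first exact: cvg_fst.
    by apply: cvg_comp cphi; exact: cvg_snd.
  by apply; rewrite mulg1; apply: open_nbhs_nbhs; split => //; exact: KU.
exists (W `&` W'); first exact: filterI.
by move=> x w w' Kx [Ww _] [_ Ww']; exact: (WU (w, w')).
Qed.

Hypothesis hG : hausdorff_space G.
Hypothesis lcG : locally_compact [set: G].

Lemma compact_nbhs (x : G) : exists2 K, compact K & nbhs x K.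
Proof.
have /= := lcG (I : [set: G] x).
rewrite /compact_near => -[K].
by rewrite withinET => xK [cK _]; exists K.
Qed.

Lemma compact_compact_nbhs K : compact K ->
  exists D C : set G, [/\ open D, compact C, K `<=` D & D `<=` C].
Proof.
move=> cK.
have [C0 cC0 C01] := compact_nbhs 1%g.
exists (\bigcup_(k in K) ((fun x : G => k^-1 * x)%g @^-1` C0°)).
exists [set (p.1 * p.2)%g | p in K `*` C0]; split.
- apply: bigcup_open => k _; apply: open_comp; last exact: open_interior.
  by move=> x _; exact: mulgl_continuous.
- exact: compact_mul.
- by move=> k Kk; exists k => //=; rewrite mulVg.
- move=> x [k Kk /= /interior_subset C0x]; exists (k, (k^-1 * x)%g) => //=.
  by rewrite mulgA mulgV mul1g.
Qed.

End GroupTopology.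

(** * Borel sets of a topological group *)

Section BorelSets.
Variable G : topologicalGroupType.

Lemma open_borel (U : set G) : open U -> measurable (U : set (borelType G)).
Proof. by move=> oU; apply: sub_sigma_algebra. Qed.

Lemma compact_borel (K : set G) : hausdorff_space G -> compact K ->
  measurable (K : set (borelType G)).
Proof.
move=> hG /(compact_closed hG) cK; rewrite -[K]setCK; apply: measurableC.
by apply: open_borel; rewrite openC.
Qed.

Lemma continuous_borel (f : G -> G) : continuous f ->
  measurable_fun setT (f : borelType G -> borelType G).
Proof.
move=> cf.
apply: (@measurability _ _ (borelType G) (borelType G) setT f (@open G)) => //.
move=> _ [U oU <-].
by rewrite setTI; apply: open_borel; apply: open_comp => // x _; exact: cf.
Qed.

Lemma preimage_borel (f : G -> G) (B : set (borelType G)) : continuous f ->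
  measurable B -> measurable (f @^-1` B : set (borelType G)).
Proof.
by move=> /continuous_borel mf mB; rewrite -[f @^-1` B]setTI; exact: mf.
Qed.

(** Finitely many left translates of the interior of [W] cover [K]; intersecting them with [K] and
    removing from each the earlier ones gives the pieces. *)
Lemma compact_borel_partition (K W : set G) : hausdorff_space G ->
  compact K -> nbhs 1%g W ->
  exists (n : nat) (s : 'I_n -> G) (E : 'I_n -> set (borelType G)),
  [/\ forall i, K (s i), forall i, measurable (E i), trivIset setT E,
     \big[setU/set0]_i E i = K &
     forall i x, E i x -> exists2 w, W w & x = (s i * w)%g].
Proof.
move=> hG cK W1.
have := cK; rewrite compact_cover.
move=> /(_ _ K (fun k => (fun x : G => k^-1 * x)%g @^-1` W°))[].
- move=> k _; apply: open_comp; last exact: open_interior.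
  by move=> x _; exact: mulgl_continuous.
- by move=> k Kk; exists k => //=; rewrite mulVg.
move=> D DK KD.
pose n := size (enum_fset D); pose t k := nth 1%g (enum_fset D) k.
have tK (i : 'I_n) : K (t i).
  by have /DK := mem_nth 1%g (ltn_ord i); rewrite inE.
pose F k : set (borelType G) := K `&` (fun x : G => (t k)^-1 * x)%g @^-1` W°.
have mF k : measurable (F k).
  apply: measurableI; first exact: compact_borel.
  apply: open_borel; apply: open_comp; last exact: open_interior.
  by move=> x _; exact: mulgl_continuous.
exists n, (fun i => t i), (fun i => seqDU F i); split => //.
- by move=> i; exact: seqDU_measurable.
- have /trivIsetP h := trivIset_seqDU F.
  by apply/trivIsetP => i j _ _ ij; exact: h.
- rewrite -(bigsetU_seqDU F n) -bigcup_mkord.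
  apply/seteqP; split=> [x [k _ []]//|x Kx].
  have [k kD kx] := KD _ Kx; exists (index k (enum_fset D)) => /=.
    by rewrite index_mem.
  by split=> //=; rewrite /t nth_index.
- move=> i x Ex; have [Kx /= /interior_subset Wx] := subset_seqDU Ex.
  by exists ((t i)^-1 * x)%g => //; rewrite mulgA mulgV mul1g.
Qed.

End BorelSets.

Lemma bigsetU_ordP T n (P : pred 'I_n) (F : 'I_n -> set T) x :
  (\big[setU/set0]_(i < n | P i) F i) x <-> exists2 i, P i & F i x.
Proof.
rewrite -bigcup_seq_cond; split=> [[i /= /andP[_ Pi] Fi]|[i Pi Fi]].
  by exists i.
by exists i => //=; rewrite mem_index_enum.
Qed.

(** * Two product inequalities between left-invariant measures *)

Section HaarComparison.
Context (R : realType) (G : topologicalGroupType).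
Local Notation B := (borelType G).
Hypothesis hG : hausdorff_space G.
Local Open Scope ereal_scope.

Definition left_invariant (m : set B -> \bar R) := forall (g : G) (A : set B),
  measurable A -> m ((fun x : G => (g * x)%g) @^-1` A) = m A.

Variables mu nu : {measure set B -> \bar R}.
Hypotheses (linv_mu : left_invariant mu) (linv_nu : left_invariant nu).

Lemma measurable_lmul (g : G) (A : set B) : measurable A ->
  measurable ((fun x : G => (g * x)%g) @^-1` A : set B).
Proof. by apply: preimage_borel => x; exact: mulgl_continuous. Qed.

Lemma measurable_invset (A : set B) : measurable A ->
  measurable ((fun x : G => x^-1%g) @^-1` A : set B).
Proof. by apply: preimage_borel => x; exact: invg_continuous. Qed.

(** Each indicator is that of the left translate [s_i O], whose [nu]-measure is [nu O]. *)
Let integral_sum_indic n (E : 'I_n -> set B) (s : 'I_n -> G) (O : set B) :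
  measurable O -> (forall i, measurable (E i)) ->
  \int[nu]_(y in setT)
    (\sum_i mu (E i) * (\1_((fun x : G => ((s i)^-1 * x)%g) @^-1` O) y)%:E) =
  (\sum_i mu (E i)) * nu O.
Proof.
move=> mO mE; rewrite ge0_integral_sum//; last first.
  move=> i; apply: measurable_funeM; apply/measurable_EFinP.
  by apply: measurable_indic; exact: measurable_lmul.
rewrite ge0_sume_distrl; last by move=> i _; exact: measure_ge0.
apply: eq_bigr => i _; rewrite ge0_integralZl//; last first.
  apply/measurable_EFinP.
  by apply: measurable_indic; exact: measurable_lmul.
rewrite integral_indic//; last exact: measurable_lmul.
by rewrite setIT linv_nu.
Qed.

(* Slicing [S] into pieces of [s_i W] makes [sum_i mu E_i 1_(s_i O)] a discrete
   substitute for the function [y |-> mu (S `&` y V^-1)], so that no Fubini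
   theorem on [G * G] is needed. *)
Lemma haar_mul_le_cover (A S : set G) (V O : set B) (W : set G) :
  compact A -> compact S -> measurable V -> measurable O -> nbhs 1%g W ->
  (forall y v, A y -> V v -> S (y * v^-1)%g) ->
  (forall w v, W w -> V v -> O (w * v)%g) ->
  mu ((fun x : G => x^-1%g) @^-1` V) * nu A <= mu S * nu O.
Proof.
move=> cA cS mV mO W1 AVS WVO.
have [n [s [E [Ss mE tE SE EW]]]] := compact_borel_partition hG cS W1.
have mA := compact_borel hG cA.
have mVi := measurable_invset mV.
have mt i := measurable_lmul (s i)^-1%g mO.
rewrite -SE (measure_bigsetU_ord mu xpredT)// -(integral_sum_indic s mO mE).
rewrite -(integral_cst nu mA).
pose f (y : B) := \sum_i mu (E i) *
  (\1_((fun x : G => ((s i)^-1 * x)%g) @^-1` O) y)%:E.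
have mf : measurable_fun setT f.
  apply: emeasurable_sum => i; apply: measurable_funeM; apply/measurable_EFinP.
  exact: measurable_indic.
have f0 y : 0 <= f y.
  by apply: sume_ge0 => i _; rewrite mule_ge0// lee_fin.
apply: (@le_trans _ _ (\int[nu]_(y in A) f y)); last first.
  exact: ge0_subset_integral.
apply: ge0_le_integral => //.
  exact: measurable_funTS.
(* For [y] in [A] the set [y V^-1] lies in [S], and any piece [E_i] meeting it satisfies
   [y \in s_i O]. The pieces counted at [y] therefore cover a left translate of [V^-1]. *)
move=> y Ay; rewrite /cst /f.
pose P i := y \in (fun x : G => ((s i)^-1 * x)%g) @^-1` O.
apply: (@le_trans _ _ (\sum_(i | P i) mu (E i))); last first.
  rewrite big_mkcond/=; apply: lee_sum => i _; rewrite indicE /P.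
  by case: ifP => _; rewrite ?mule1// mule0.
rewrite -measure_bigsetU_ord//.
rewrite -(linv_mu y^-1%g mVi); apply: le_measure; rewrite ?inE.
- exact: measurable_lmul.
- exact: bigsetU_measurable.
move=> x /= Vx; have : S x.
  by have := AVS _ _ Ay Vx; rewrite invgK mulgA mulgV mul1g.
rewrite -SE => /bigsetU_ordP[i _ Ex]; apply/bigsetU_ordP; exists i => //.
have [w Ww xE] := EW _ _ Ex.
rewrite /P inE /=.
by have := WVO _ _ Ww Vx; rewrite xE !invgM invgK !mulgA mulgV mul1g.
Qed.

(** The dual bound: the disjoint pieces [E_i] of [K] with [y \in s_i V] all lie in [y O], and there
    are none unless [y] is in [U]. So the sum of the [mu E_i] counted at [y] is at most [mu O] on
    [U] and zero elsewhere. *)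
Lemma haar_mul_le_packing (K : set G) (V U O : set B) (W : set G) :
  compact K -> measurable V -> measurable U -> measurable O -> nbhs 1%g W ->
  (forall k v, K k -> V v -> U (k * v)%g) ->
  (forall v w, V v -> W w -> O (v^-1 * w)%g) ->
  mu K * nu V <= mu O * nu U.
Proof.
move=> cK mV mU mO W1 KVU VWO.
have [n [s [E [Ks mE tE KE EW]]]] := compact_borel_partition hG cK W1.
have mt i := measurable_lmul (s i)^-1%g mV.
rewrite -KE (measure_bigsetU_ord mu xpredT)// -(integral_sum_indic s mV mE).
have -> : mu O * nu U = \int[nu]_(y in setT) (mu O * (\1_U y)%:E).
  rewrite ge0_integralZl//; last exact/measurable_EFinP/measurable_indic.
  by rewrite integral_indic// setIT.
apply: ge0_le_integral => //.
- by move=> y _; apply: sume_ge0 => i _; rewrite mule_ge0// lee_fin.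
- apply: emeasurable_sum => i; apply: measurable_funeM; apply/measurable_EFinP.
  exact: measurable_indic.
- by apply: measurable_funeM; exact/measurable_EFinP/measurable_indic.
move=> y _; rewrite [in leRHS]indicE.
pose P i := y \in (fun x : G => ((s i)^-1 * x)%g) @^-1` V.
have -> : \sum_i mu (E i) *
    (\1_((fun x : G => ((s i)^-1 * x)%g) @^-1` V) y)%:E =
    \sum_(i | P i) mu (E i).
  rewrite [RHS]big_mkcond/=; apply: eq_bigr => i _; rewrite indicE /P.
  by case: ifP => _; rewrite ?mule1// mule0.
case: (boolP (y \in U)) => [|/negP]; rewrite inE => Uy; last first.
  rewrite mule0 big_pred0// => i; apply/negP; rewrite /P inE /= => Vy.
  by apply: Uy; have := KVU _ _ (Ks i) Vy; rewrite mulgA mulgV mul1g.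
rewrite mule1 -measure_bigsetU_ord//.
rewrite -(linv_mu y^-1%g mO); apply: le_measure; rewrite ?inE.
- exact: bigsetU_measurable.
- exact: measurable_lmul.
move=> x Ex; have [i + Eix] : exists2 i, P i & E i x by exact/bigsetU_ordP.
rewrite /P inE /= => Vy; have [w Ww ->] := EW _ _ Eix.
by have := VWO _ _ Vy Ww; rewrite invgM invgK mulgA.
Qed.

End HaarComparison.

(** * Proportionality of left-invariant measures on compact sets *)

Section HaarUniqueness.
Context (R : realType) (G : topologicalGroupType).
Local Notation B := (borelType G).
Hypothesis hG : hausdorff_space G.
Local Open Scope ereal_scope.

(** A form of regularity that passes directly to the push-forward under a right translation, a
    homeomorphism. *)
Definition compact_outer_regular (m : set B -> \bar R) := forall K : set G,
  compact K -> m K < +oo /\ forall e : R, (0 < e)%R ->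
    exists U : set G, [/\ open U, K `<=` U & m U <= m K + e%:E].

Lemma le_mul_outer (m : {measure set B -> \bar R}) (K : set G) (a b : \bar R) :
  compact_outer_regular m -> compact K -> 0 <= b -> b < +oo ->
  (forall U : set G, open U -> K `<=` U -> m U < +oo -> a <= b * m U) ->
  a <= b * m K.
Proof.
move=> om cK; case: b => [r| |]//; rewrite lee_fin => r0 _ h.
have [mKoo eK] := om _ cK.
apply/lee_addgt0Pr => e e0.
have r1 : (0 < r + 1)%R by rewrite ltr_wpDl.
(* Dividing by [r + 1] instead of [r] also covers [r = 0]. *)
have [U [oU KU mU]] := eK (e / (r + 1))%R (divr_gt0 e0 r1).
have mUoo : m U < +oo.
  by apply: le_lt_trans mU _; rewrite lte_add_pinfty// ltry.
apply: le_trans (h _ oU KU mUoo) _.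
apply: (@le_trans _ _ (r%:E * (m K + (e / (r + 1))%:E))).
  by rewrite lee_wpmul2l// lee_fin.
rewrite muleDr//; last by rewrite ge0_adde_def// inE// lee_fin divr_ge0// ltW.
rewrite leeD2l// -EFinM lee_fin mulrCA ler_piMr//; first exact: ltW.
by rewrite ler_pdivrMr// mul1r lerDl.
Qed.

(** Exchanging [K1] and [K2] gives the reverse inequality, so this amounts to proportionality of
    [mu] and [nu] on compact sets. *)
Lemma haar_compare (mu nu : {measure set B -> \bar R}) (K1 K2 : set G) :
  left_invariant mu -> left_invariant nu ->
  compact_outer_regular mu -> compact_outer_regular nu ->
  (forall U : set G, open U -> U !=set0 ->
    exists K : set G, [/\ compact K, K `<=` U & 0 < mu K]) ->
  compact K1 -> compact K2 -> nu K1 * mu K2 <= mu K1 * nu K2.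
Proof.
move=> lmu lnu omu onu pmu cK1 cK2.
suff h (U1 U2 : set G) : open U1 -> K1 `<=` U1 -> mu U1 < +oo ->
    open U2 -> K2 `<=` U2 -> nu U2 < +oo -> nu K1 * mu K2 <= mu U1 * nu U2.
  rewrite muleC [leRHS]muleC; apply: le_mul_outer => // [|U1 oU1 KU1 mU1].
    by have [] := onu _ cK2.
  rewrite muleC [leRHS]muleC.
  by apply: le_mul_outer => // U2 oU2 KU2 mU2; exact: h.
move=> oU1 KU1 mU1 oU2 KU2 mU2.
pose phi (p : G * G) : G := (p.1^-1 * p.2)%g.
pose psi (p : G * G) : G := (p.1 * p.2)%g.
have cphi : phi @ nbhs (1%g, 1%g) --> (1%g : G).
  rewrite -[X in _ --> X](mulVg 1%g); apply: mul_cvg; last exact: cvg_snd.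
  by apply: continuous_cvg; [exact: invg_continuous|exact: cvg_fst].
have cpsi : psi @ nbhs (1%g, 1%g) --> (1%g : G).
  rewrite -[X in _ --> X](mul1g 1%g).
  by apply: mul_cvg; [exact: cvg_fst|exact: cvg_snd].
have [N1 N11 N1U] := nbhs1_mulr2_sub cphi cK1 oU1 KU1.
have [N2 N21 N2U] := nbhs1_mulr2_sub cpsi cK2 oU2 KU2.
(* [N] is so small that [K1 N^-1] lies in [U1] and [K2 N N] lies in [U2]. *)
pose N := (N1 `&` N2)°.
have N1' : N 1%g.
  by apply: nbhs_singleton; apply: nbhs_interior; exact: filterI.
have oN : open N by exact: open_interior.
have oNi : open ((fun x : G => x^-1%g) @^-1` N).
  by apply: open_comp => // x _; exact: invg_continuous.
(* Positivity of [mu V'] allows this factor to be cancelled at the end. *)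
have [V' [cV' V'N V'0]] : exists K : set G,
    [/\ compact K, K `<=` (fun x : G => x^-1%g) @^-1` N & 0 < mu K].
  by apply: pmu => //; exists 1%g; rewrite /= invg1.
pose V := (fun x : G => x^-1%g) @^-1` V'.
have ViE : (fun x : G => x^-1%g) @^-1` V = V'.
  by apply/seteqP; split => x; rewrite /V /= invgK.
have cV : compact V by rewrite /V -inv_imageE; exact: compact_inv.
have VN v : V v -> N v by move=> /V'N /=; rewrite invgK.
pose S := [set (p.1 * p.2)%g | p in K1 `*` V'].
have cS : compact S by exact: compact_mul.
have SU1 : S `<=` U1.
  move=> _ [[k v] [/= K1k V'v] <-].
  have /interior_subset[N1v _] := V'N _ V'v.
  have := N1U k v^-1%g 1%g K1k N1v (nbhs_singleton N11).
  by rewrite /phi /= invgK mulg1.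
have mV'oo : mu V' < +oo by have [] := omu _ cV'.
(* Both bounds below involve [nu Q] with [Q = W V], which cancels, while [O] can
   be shrunk down to [V^-1 = V']. *)
suff hO (O : set G) : open O -> V' `<=` O -> mu O < +oo ->
    nu K1 * mu K2 * mu V' <= (mu U1 * nu U2) * mu O.
  have : nu K1 * mu K2 * mu V' <= (mu U1 * nu U2) * mu V'.
    apply: le_mul_outer => //.
    by apply: lte_mul_pinfty => //; rewrite ge0_fin_numE.
  by rewrite lee_pmul2r// ge0_fin_numE.
move=> oO V'O mO.
(* With [W] inside [W'], the set [V^-1 W^-1 W] lies in [O], as the packing bound for [Q = W V]
   requires. *)
have [W' W'1 W'O] := nbhs1_mulr2_sub cphi cV' oO V'O.
pose W := W'° `&` N.
have oW : open W by apply: openI => //; exact: open_interior.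
have W1 : nbhs 1%g W.
  by apply: open_nbhs_nbhs; split.
pose Q := \bigcup_(v in V) ((fun x : G => x * v^-1)%g @^-1` W).
have oQ : open Q.
  apply: bigcup_open => v _.
  by apply: open_comp => // x _; exact: mulgr_continuous.
have mV : measurable (V : set B) by exact: compact_borel.
have le1 : mu V' * nu K1 <= mu S * nu Q.
  rewrite -[X in mu X * _]ViE; apply: haar_mul_le_cover W1 _ _ => //.
  - exact: open_borel.
  - by move=> y v K1y Vv; exists (y, v^-1%g).
  - by move=> w v Ww Vv; exists v => //=; rewrite -mulgA mulgV mulg1.
have le2 : mu K2 * nu Q <= mu O * nu U2.
  apply: haar_mul_le_packing W1 _ _ => //; try exact: open_borel.
  - move=> k q K2k [v Vv /= [_ /interior_subset[_ N2w]]].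
    have /interior_subset[_ N2v] := VN _ Vv.
    by have := N2U _ _ _ K2k N2w N2v; rewrite /psi /= -!mulgA mulVg mulg1.
  - move=> q w [v Vv /= [/interior_subset W'q _]] [/interior_subset W'w _].
    have := W'O _ _ _ Vv W'q W'w.
    by rewrite /phi /= invgM invgK !mulgA mulVg mul1g.
rewrite muleC muleA.
apply: (@le_trans _ _ (mu S * nu Q * mu K2)); first exact: lee_wpmul2r.
apply: (@le_trans _ _ (mu S * (mu O * nu U2))).
  by rewrite -muleA; apply: lee_wpmul2l => //; rewrite muleC.
rewrite muleAC -muleA; apply: lee_wpmul2r; first exact: mule_ge0.
apply: le_measure => //; rewrite inE; first exact: compact_borel.
exact: open_borel.
Qed.

End HaarUniqueness.

(** * Haar measure: positivity on open sets, right translates, inversion *)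

Section LeftHaar.
Context (R : realType) (G : topologicalGroupType).
Local Notation B := (borelType G).
Variable mu : {measure set B -> \bar R}.
Hypothesis hG : hausdorff_space G.
Hypothesis lcG : locally_compact [set: G].
Hypothesis haar_mu : left_haar_measure mu.
Local Open Scope ereal_scope.

Lemma haar_left_invariant : left_invariant mu.
Proof.
have [_ _ h] := haar_mu; move=> g A mA; rewrite -(h g^-1%g A mA); congr (mu _).
apply/seteqP; split=> [x /= Ax|_ [x Ax <-]] /=.
  by exists (g * x)%g => //; rewrite mulgA mulVg mul1g.
by rewrite mulgA mulgV mul1g.
Qed.

Lemma haar_compact_lty (K : set G) : compact K -> mu K < +oo.
Proof. by have [[h _ _] _ _] := haar_mu; exact: h. Qed.

Lemma haar_open_sup (U : set G) : open U ->
  mu U = ereal_sup [set mu K | K in [set K : set G | compact K /\ K `<=` U]].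
Proof. by have [[_ _ h] _ _] := haar_mu; exact: h. Qed.

Lemma haar_outer (A : set B) (e : R) :
  measurable A -> mu A < +oo -> (0 < e)%R ->
  exists U : set G, [/\ open U, A `<=` U & mu U <= mu A + e%:E].
Proof.
move=> mA Aoo e0; have [[_ h _] _ _] := haar_mu.
have := h A mA; set S := [set mu U | U in _] => AE.
have Sfin : ereal_inf S \is a fin_num by rewrite -AE ge0_fin_numE.
have [_ [U [oU AU] <-] UA] := lb_ereal_inf_adherent e0 Sfin.
by exists U; split => //; rewrite AE; exact: ltW.
Qed.

Lemma haar_compact_outer : compact_outer_regular mu.
Proof.
move=> K cK; split; first exact: haar_compact_lty.
move=> e e0; apply: haar_outer => //; first exact: compact_borel.
exact: haar_compact_lty.
Qed.

(** If [U] were null, every compact set would be a finite union of pieces of left translates of [U],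
    hence null, and inner regularity on the whole group would give [mu = 0]. *)
Lemma haar_open_gt0 (U : set G) : open U -> U !=set0 -> 0 < mu U.
Proof.
move=> oU [u Uu]; rewrite lt0e measure_ge0 andbT; apply/eqP => U0.
have [_ /eqP + _] := haar_mu; apply.
apply/eqP; rewrite -measure_le0.
have /eqP := haar_open_sup (@openT G).
rewrite eq_le => /andP[/le_trans + _]; apply.
apply: ge_ereal_sup => _ [K [cK _] <-].
have W1 : nbhs 1%g ((fun x : G => (u * x)%g) @^-1` U).
  apply: open_nbhs_nbhs; split; last by rewrite /= mulg1.
  by apply: open_comp => // x _; exact: mulgl_continuous.
have [n [s [E [_ mE tE <- EW]]]] := compact_borel_partition hG cK W1.
rewrite (measure_bigsetU_ord mu xpredT)// big1// => i _.
apply/eqP; rewrite -measure_le0 -U0.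
have mU := open_borel oU.
rewrite -(haar_left_invariant (u * (s i)^-1)%g mU).
apply: le_measure; rewrite ?inE//.
  exact: measurable_lmul.
by move=> x /EW[w /= Uw ->]; rewrite -mulgA (mulgA (s i)^-1%g) mulVg mul1g.
Qed.

Lemma haar_inner_gt0 (U : set G) : open U -> U !=set0 ->
  exists K : set G, [/\ compact K, K `<=` U & 0 < mu K].
Proof.
move=> oU U0; have := haar_open_gt0 oU U0.
rewrite (haar_open_sup oU) => /ereal_sup_gt[_ [K [cK KU] <-] K0].
by exists K.
Qed.

Section Modular.
Variable g : G.
Let rho (x : G) : G := (x * g)%g.
Let mrho : measurable_fun setT (rho : B -> B).
Proof. by apply: continuous_borel => x; exact: mulgr_continuous. Qed.

Let rho_preim (A : set G) : rho @^-1` A = [set (x * g^-1)%g | x in A].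
Proof.
apply/seteqP; split=> [x /= Ax|_ [x Ax <-]] /=.
  by exists (x * g)%g => //; rewrite -mulgA mulgV mulg1.
by rewrite /rho -mulgA mulVg mulg1.
Qed.

Let rhoV_preim (A : set G) : rho @^-1` ((fun x : G => x * g^-1)%g @^-1` A) = A.
Proof.
by apply/seteqP; split=> x /=; rewrite /rho -mulgA mulgV mulg1.
Qed.

Let compact_rho (K : set G) : compact K -> compact (rho @^-1` K).
Proof.
move=> cK; rewrite rho_preim; apply: continuous_compact => //.
by apply: continuous_subspaceT => x; exact: mulgr_continuous.
Qed.

Let compact_rhoV (K : set G) : compact K ->
  compact ((fun x : G => x * g^-1)%g @^-1` K).
Proof.
move=> cK.
have -> : (fun x : G => x * g^-1)%g @^-1` K = [set (x * g)%g | x in K].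
  apply/seteqP; split=> [x /= Ax|_ [x Ax <-]] /=.
    by exists (x * g^-1)%g => //; rewrite -mulgA mulVg mulg1.
  by rewrite -mulgA mulgV mulg1.
apply: continuous_compact => //.
by apply: continuous_subspaceT => x; exact: mulgr_continuous.
Qed.

Let open_rhoV (U : set G) : open U -> open ((fun x : G => x * g^-1)%g @^-1` U).
Proof. by move=> oU; apply: open_comp => // x _; exact: mulgr_continuous. Qed.

Let open_rho (U : set G) : open U -> open (rho @^-1` U).
Proof. by move=> oU; apply: open_comp => // x _; exact: mulgr_continuous. Qed.

Let nu : {measure set B -> \bar R} :=
  measure_function_pushforward__canonical__measure_function_Measure mu mrho.

Let nuE A : nu A = mu (rho @^-1` A). Proof. by []. Qed.

(** The constant is a value of the modular function. Left and right translations commute, so the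
    push-forward [nu] is left invariant and proportional to [mu] on compact sets; inner regularity
    extends this to open sets and outer regularity to Borel sets. *)
Lemma haar_right_translate : exists2 c : R, (0 < c)%R &
  forall A : set B, measurable A ->
    mu ((fun x : G => (x * g)%g) @^-1` A) = c%:E * mu A.
Proof.
have lnu : left_invariant nu.
  move=> h A mA; rewrite !nuE.
  rewrite -(haar_left_invariant h (preimage_borel (@mulgr_continuous G g) mA)).
  by congr (mu _); apply/seteqP; split => x; rewrite /rho /= mulgA.
have onu : compact_outer_regular nu.
  move=> K cK; split; first exact/haar_compact_lty/compact_rho.
  have [_ rho_outer] := haar_compact_outer (compact_rho cK).
  move=> e /rho_outer[U [oU KU mU]].
  exists ((fun x : G => x * g^-1)%g @^-1` U); split.
  - exact: open_rhoV.
  - by move=> x Kx /=; apply: KU; rewrite /rho /= -mulgA mulVg mulg1.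
  - by rewrite !nuE rhoV_preim.
have [K0 [cK0 _ K0gt0]] := haar_inner_gt0 (@openT G) (ex_intro _ 1%g I).
have le (K K' : set G) : compact K -> compact K' ->
    nu K * mu K' <= mu K * nu K'.
  move=> cK cK'; apply: (@haar_compare _ _ hG mu nu) => //.
  - exact: haar_left_invariant.
  - exact: haar_compact_outer.
  - exact: haar_inner_gt0.
have fin (K : set G) : compact K -> mu K \is a fin_num.
  by move=> cK; rewrite ge0_fin_numE// haar_compact_lty.
have nfin (K : set G) : compact K -> nu K \is a fin_num.
  by move=> cK; rewrite ge0_fin_numE//; have [] := onu _ cK.
have k0 : (0 < fine (mu K0))%R by rewrite fine_gt0// K0gt0 ltey_eq fin.
pose c := (fine (nu K0) / fine (mu K0))%R.
have c0 : (0 <= c)%R by rewrite divr_ge0// fine_ge0.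
have cE (K : set G) : compact K -> nu K = c%:E * mu K.
  move=> cK; have : nu K * mu K0 = nu K0 * mu K.
    apply/eqP; rewrite eq_le [X in _ <= X]muleC le//=.
    by apply: le_trans (le _ _ cK0 cK) _; rewrite muleC.
  rewrite -(fineK (fin _ cK)) -(fineK (nfin _ cK)) -(fineK (fin _ cK0)).
  rewrite -(fineK (nfin _ cK0)) -!EFinM => -[h]; congr EFin.
  by rewrite /c mulrAC -h mulfK// gt_eqF.
have cU (U : set G) : open U -> nu U = c%:E * mu U.
  move=> oU; rewrite nuE (haar_open_sup (open_rho oU)) (haar_open_sup oU).
  rewrite -ereal_supZl//; last first.
    by apply/set0P; exists (mu set0), set0 => //; split => //; exact: compact0.
  congr ereal_sup; apply/seteqP.
  split=> [_ [K [cK KU] <-]|_ [_ [K [cK KU] <-] <-]].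
    exists (mu ((fun x : G => x * g^-1)%g @^-1` K)).
      exists ((fun x : G => x * g^-1)%g @^-1` K) => //.
      split; first exact: compact_rhoV.
      by move=> x /= /KU; rewrite /rho /= -mulgA mulVg mulg1.
    by rewrite -cE ?nuE ?rhoV_preim//; exact: compact_rhoV.
  exists (rho @^-1` K); last by rewrite -cE.
  by split; [exact: compact_rho|move=> x /= /KU].
(* Right translation preserves the whole group, so [c = 0] would force [mu setT = 0]. *)
have cgt0 : (0 < c)%R.
  rewrite lt_neqAle c0 andbT; apply/eqP => c0E.
  have [_ /eqP + _] := haar_mu; apply.
  by have := cU _ (@openT G); rewrite -c0E mul0e.
exists c => // A mA.
have [[_ h _] _ _] := haar_mu.
rewrite (h _ mA) -ereal_inf_pZl// h; last first.
  by apply: preimage_borel mA; exact: mulgr_continuous.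
congr ereal_inf; apply/seteqP.
split=> [_ [U [oU AU] <-]|_ [_ [U [oU AU] <-] <-]].
  exists (mu ((fun x : G => x * g^-1)%g @^-1` U)).
    exists ((fun x : G => x * g^-1)%g @^-1` U) => //.
    split; first exact: open_rhoV.
    by move=> x Ax /=; apply: AU; rewrite /= -mulgA mulVg mulg1.
  by rewrite -cU ?nuE ?rhoV_preim//; exact: open_rhoV.
exists (rho @^-1` U); last by rewrite -cU.
by split; [exact: open_rho|move=> x /= /AU].
Qed.

End Modular.

(** The covering bound with [nu = mu] gives [mu (V^-1) * mu A <= mu S * mu U] for compact [V] inside
    a small open neighbourhood [U] of [N]. With [A] of positive finite measure and [mu U]
    arbitrarily small, the inverse of [N] is null. *)
Lemma haar_inv_null (C : set G) (N : set B) : compact C -> measurable N ->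
  N `<=` C -> mu N = 0 -> mu ((fun x : G => x^-1%g) @^-1` N) = 0.
Proof.
move=> cC mN NC N0.
have [D [C' [oD cC' CD DC']]] := compact_compact_nbhs lcG cC.
have [A [cA _ A0]] := haar_inner_gt0 (@openT G) (ex_intro _ 1%g I).
pose S := [set (p.1 * p.2)%g | p in A `*` [set x^-1%g | x in C']].
have cS : compact S by apply: compact_mul => //; exact: compact_inv.
have oinv (U : set G) : open U -> open ((fun x : G => x^-1%g) @^-1` U).
  by move=> oU; apply: open_comp => // x _; exact: invg_continuous.
have mNi := measurable_invset mN.
have Afin : mu A \is a fin_num by rewrite ge0_fin_numE// haar_compact_lty.
have Sfin : mu S \is a fin_num by rewrite ge0_fin_numE// haar_compact_lty.
suff h (e : R) : (0 < e)%R ->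
    mu ((fun x : G => x^-1%g) @^-1` N) * mu A <= mu S * e%:E.
  apply/eqP; rewrite -measure_le0 -(@lee_pmul2r _ (mu A))// mul0e.
  apply/lee_addgt0Pr => e e0; rewrite add0e.
  have s1 : (0 < fine (mu S) + 1)%R by rewrite ltr_wpDl// fine_ge0.
  apply: le_trans (h _ (divr_gt0 e0 s1)) _.
  rewrite -(fineK Sfin) -EFinM lee_fin mulrCA ler_piMr//; first exact: ltW.
  by rewrite ler_pdivrMr// mul1r lerDl.
move=> e0.
have Noo : mu N < +oo by rewrite N0.
have [U0 [oU0 NU0]] := haar_outer mN Noo e0; rewrite N0 add0e => U0e.
(* Cutting by [D] keeps [U] inside the compact [C'], so that [S = A C'^-1] does not depend on
   [e]. *)
pose U := U0 `&` D.
have oU : open U by exact: openI.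
have mU := open_borel oU.
have NU : N `<=` U by move=> x Nx; split; [exact: NU0|exact/CD/NC].
have Ue : mu U <= e%:E.
  apply: le_trans U0e; apply: le_measure => //; rewrite ?inE//.
    exact: open_borel.
  by move=> x [].
apply: (@le_trans _ _ (mu ((fun x : G => x^-1%g) @^-1` U) * mu A)).
  apply: lee_wpmul2r => //; apply: le_measure; rewrite ?inE//.
    exact: measurable_invset.
  by move=> x; exact: NU.
(* Inner regularity reduces the open set [U^-1] to its compact subsets [V'], whose inverses [V]
   satisfy [W V] inside [U] for some neighbourhood [W] of the identity. *)
rewrite (haar_open_sup (oinv _ oU)) muleC -(fineK Afin).
rewrite -ereal_supZl; last 2 first.
- by apply/set0P; exists (mu set0), set0 => //; split => //; exact: compact0.
- exact: fine_ge0.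
rewrite fineK//; apply: ge_ereal_sup => _ [_ [V' [cV' V'U] <-] <-].
pose V := (fun x : G => x^-1%g) @^-1` V'.
have ViE : (fun x : G => x^-1%g) @^-1` V = V'.
  by apply/seteqP; split => x; rewrite /V /= invgK.
have cV : compact V by rewrite /V -inv_imageE; exact: compact_inv.
have VU : V `<=` U by move=> x /V'U /=; rewrite invgK.
have W1 := nbhs1_mull_sub cV oU VU.
apply: (@le_trans _ _ (mu S * mu U)); last exact: lee_wpmul2l.
have mV : measurable (V : set B) by exact: compact_borel.
have := haar_mul_le_cover hG haar_left_invariant haar_left_invariant cA cS mV
  mU W1.
rewrite ViE muleC; apply; last by move=> w v /= + Vv; apply.
move=> y v Ay Vv; exists (y, v^-1%g) => //; split => //=.
by exists v => //; have [_ /DC'] := VU _ Vv.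
Qed.

End LeftHaar.

(** * Transfinite choice of points with disjoint translates *)

Section Translates.
Context (G : topologicalGroupType) (d : Order.disp_t) (eta : orderType d).
Hypothesis hG : hausdorff_space G.
Hypothesis lcG : locally_compact [set: G].
Hypothesis ncG : ~ compact [set: G].
Hypothesis ord_eta : initial_ordinal eta.
Hypothesis cov_eta : is_compact_covering_number G eta.

(** A covering by compact sets need not absorb a given compact set into finitely many of its
    members. Enlarging each member to a compact neighbourhood makes the interiors an open cover. *)
Lemma exists_compact_family : exists C : eta -> set G,
  (forall i, compact (C i)) /\
  forall K, compact K -> exists s : seq eta, K `<=` \bigcup_(i in [set` s]) C i.
Proof.
have [[F [[cF FT] Feta]] _] := cov_eta.
have [F0|[phi]] : F = set0 \/ $|{surjfun [set: eta] >-> F}|.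
  by apply/pfcard_geP; have /card_eqPle[] := Feta.
  have : (\bigcup_(K in F) K) (1%g : G) by rewrite FT.
  by rewrite F0 bigcup_set0.
have cphi i : compact (phi i) by apply: cF; exact: funS.
have /choice[C CP] : forall i, exists C : set G, exists D : set G,
    [/\ open D, compact C, phi i `<=` D & D `<=` C].
  move=> i; have [D [C DC]] := compact_compact_nbhs lcG (cphi i).
  by exists C, D.
have /choice[D DP] := CP.
exists C; split => [i|K]; first by have [] := DP i.
rewrite compact_cover => /(_ eta setT D)[|x Kx|s _ Ks].
- by move=> i _; have [] := DP i.
- have [L FL Lx] : (\bigcup_(L in F) L) x by rewrite FT.
  have [i _ phiL] := 'surj_phi FL.
  by exists i => //; have [_ _ + _] := DP i; apply; rewrite phiL.
- exists (enum_fset s) => x /Ks[i si Dx]; exists i => //.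
  by have [_ _ _] := DP i; apply.
Qed.

Lemma not_covered_below (a : eta) (F : eta * (eta * eta) -> set G) :
  (forall p, compact (F p)) ->
  let M := [set j : eta | (j <= a)%O] in
  exists z, forall p, (M `*` (M `*` M)) p -> ~ F p z.
Proof.
move=> cF M; apply: contrapT => /forallNP h.
set T := M `*` (M `*` M).
have GT : \bigcup_(p in T) F p = [set: G].
  apply/seteqP; split=> // z _.
  have /existsNP[p /not_implyP[Tp /contrapT Fz]] := h z.
  by exists p.
have [_ /(_ (F @` T))] := cov_eta.
have [wf_eta init_eta] := ord_eta.
(* A finite [M] would make [G] a finite union of compact sets, hence compact. *)
have Minf : infinite_set M.
  move=> Mfin; have /finite_seqP[s Ts] : finite_set T.
    by do 2 apply: finite_setX => //.
  apply: ncG; rewrite -GT Ts bigcup_seq.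
  by apply: bigsetU_compact.
have ME : M = [set j | (j < a)%O] `|` [set a] := le_segmentE a.
have ainf : infinite_set [set j | (j < a)%O].
  by move=> afin; apply: Minf; rewrite ME finite_setU.
have Ma : M #<= [set j | (j < a)%O] by rewrite ME; exact: card_le_setU1.
have aa := card_le_square_segment wf_eta ainf.
have aMM : M `*` M #<= [set j | (j < a)%O].
  exact: card_le_trans (card_le_setX Ma Ma) aa.
have aT : T #<= [set j | (j < a)%O].
  exact: card_le_trans (card_le_setX Ma aMM) aa.
have cov : compact_covering (F @` T).
  by split=> [_ [p _ <-]//|]; rewrite bigcup_image.
(* Minimality of the covering number would embed [eta] into the segment below [a], which is
   impossible for an initial ordinal. *)
move=> /(_ cov) /card_le_trans/(_ (card_image_le _ _)).
by move=> /card_le_trans/(_ aT); exact: init_eta.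
Qed.

Lemma exists_disjoint_translates (C : eta -> set G) :
  (forall i, compact (C i)) ->
  exists x : eta -> G, forall a b i j u v,
    (b < a)%O -> (i <= a)%O -> (j <= b)%O ->
    C i u -> C j v -> (u * x a)%g <> (v * x b)%g.
Proof.
move=> cC; have [wf_eta _] := ord_eta.
pose P a (x : eta -> G) z := forall b i j u v, (b < a)%O -> (i <= a)%O ->
  (j <= b)%O -> C i u -> C j v -> (u * z)%g <> (v * x b)%g.
have [||x xP] := @wf_choice _ _ _ P (1%g : G) wf_eta.
- move=> a x x' z xx' Px b i j u v ba ia jb Cu Cv.
  by rewrite -xx'//; exact: Px Cu Cv.
- move=> a x.
  (* The equation [u z = v x_b] means [z = u^-1 v x_b], so the forbidden [z] form the compact sets
     [C_i^-1 C_j x_b]. *)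
  pose D (i j : eta) : set G :=
    [set q.1 * q.2 | q in [set u^-1 | u in C i] `*` C j]%g.
  pose F (p : eta * (eta * eta)) :=
    [set (q.1 * q.2)%g | q in D p.2.1 p.2.2 `*` [set x p.1]].
  have cF p : compact (F p).
    apply: compact_mul; last exact: compact_set1.
    by apply: compact_mul => //; exact: compact_inv.
  have [z zP] := not_covered_below a cF.
  exists z => b i j u v ba ia jb Cu Cv uz.
  apply: (zP (b, (i, j))).
    by split; [exact: ltW|split => //=; exact: le_trans jb (ltW ba)].
  exists ((u^-1 * v)%g, x b) => /=; last first.
    by rewrite -mulgA -uz mulgA mulVg mul1g.
  by split => //; exists (u^-1%g, v) => //; split => //; exists u.
by exists x => a; exact: xP.
Qed.

End Translates.

(** * Scaling of real and complex integrals *)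

Section RintegralScaling.
Context d (T : measurableType d) (R : realType).
Variable mu : {measure set T -> \bar R}.
Local Open Scope ereal_scope.

(** Stated for measurable functions because a convolution integral may diverge at some points. A
    positive factor respects positive and negative parts and fixes infinite values, which [fine]
    sends to 0 on both sides. *)
Lemma measurable_Rintegral_pZl (c : R) (f : T -> R) : (0 < c)%R ->
  measurable_fun setT f ->
  (\int[mu]_x (c * f x) = c * \int[mu]_x f x)%R.
Proof.
move=> c0 mf; pose F := fun x => (f x)%:E.
have mF : measurable_fun setT F by exact/measurable_EFinP.
rewrite /Rintegral.
have -> : \int[mu]_x (c * f x)%:E = c%:E * \int[mu]_x F x.
  rewrite (integralE _ _ (fun x => (c * f x)%:E)) (integralE _ _ F).
  have -> : (fun x => (c * f x)%:E) = (fun x => c%:E * F x) by [].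
  rewrite ge0_funeposM ?ltW// ge0_funenegM ?ltW//.
  rewrite !ge0_integralZl//; last 4 first.
  - exact: measurable_funeneg.
  - by rewrite lee_fin ltW.
  - exact: measurable_funepos.
  - by rewrite lee_fin ltW.
  have : 0 <= \int[mu]_x F^\+ x by exact: integral_ge0.
  have : 0 <= \int[mu]_x F^\- x by exact: integral_ge0.
  case: (\int[mu]_x F^\+ x) (\int[mu]_x F^\- x) => [a| |] [b| |]//= _ _.
  - by rewrite -EFinM -!EFinD -EFinM mulrDr mulrN.
  - by rewrite gt0_muley// -EFinM addeNy gt0_muleNy.
  - by rewrite gt0_muley// addye// addye// gt0_muley.
  - by rewrite gt0_muley// addeNy gt0_muleNy.
case: (\int[mu]_x F x) => [a| |]//=.
  by rewrite gt0_muley// mulr0.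
by rewrite gt0_muleNy// mulr0.
Qed.

End RintegralScaling.

Section ComplexIntegrable.
Context d (T : measurableType d) (R : realType).
Variable mu : {measure set T -> \bar R}.

Lemma cintegrableZ (a : R[i]) (f : T -> R[i]^o) :
  cintegrable mu f -> cintegrable mu (fun x => a * f x).
Proof.
move=> /asboolP fi; apply/asboolP; have [h0 hZ] := l1fun_submod_closed mu.
by have := hZ a f 0 fi h0; rewrite addr0.
Qed.

Lemma cintegrableZE (a : R[i]) (f : T -> R[i]^o) : a != 0 ->
  cintegrable mu (fun x => a * f x) <-> cintegrable mu f.
Proof.
move=> a0; split=> [|/cintegrableZ]; last exact.
move=> /(cintegrableZ a^-1); congr cintegrable; apply/funext => x.
by rewrite mulrA mulVf// mul1r.
Qed.

Definition mk_l1fun (f : T -> R[i]^o) (fi : cintegrable mu f) : l1fun mu :=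
  L1fun (introT (asboolP (cintegrable mu f)) fi : f \in l1fun_pred mu).

End ComplexIntegrable.

Lemma L1_normE d (T : measurableType d) (R : realType)
  (mu : {measure set T -> \bar R}) (f : L1 mu) : `|f| = L1_norm f.
Proof. by []. Qed.

(** * Normalised right translation as an isometry of [L1 mu] *)

Section RightTranslation.
Context (R : realType) (G : topologicalGroupType).
Local Notation B := (borelType G).
Variables (mu : {measure set B -> \bar R}) (g : G) (k : R).
Hypothesis k_gt0 : 0 < k.
Hypothesis mu_rmul : forall A : set B, measurable A ->
  (mu ((fun x : G => (x * g)%g) @^-1` A) = k%:E * mu A)%E.

Let rho : B -> B := fun x : G => (x * g)%g.

Lemma measurable_rmul (h : G) :
  measurable_fun setT ((fun x : G => x * h)%g : B -> B).
Proof. by apply: continuous_borel => x; exact: mulgr_continuous. Qed.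

Let mrho : measurable_fun setT rho. Proof. exact: measurable_rmul. Qed.

Lemma ge0_integral_rmul (h : B -> \bar R) : measurable_fun setT h ->
  (forall x, 0 <= h x)%E ->
  (\int[mu]_x h (rho x) = k%:E * \int[mu]_x h x)%E.
Proof.
move=> mh h0.
rewrite -(@ge0_integral_mscale _ _ _ mu _ measurableT (NngNum (ltW k_gt0)))//.
rewrite -[LHS]/(\int[mu]_(x in rho @^-1` setT) (h \o rho) x)%E.
rewrite -ge0_integral_pushforward//.
by apply: eq_measure_integral => A mA _; exact: mu_rmul.
Qed.

Lemma ae_rmul (P : set B) : (\forall x \ae mu, P x) ->
  \forall x \ae mu, P (rho x).
Proof.
move=> [N [mN N0 PN]]; exists (rho @^-1` N); split.
- by rewrite -[_ @^-1` _]setTI; exact: mrho.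
- by rewrite mu_rmul// N0 mule0.
- by move=> x /PN.
Qed.

Lemma measurable_fun_rmulE (f : B -> R) :
  measurable_fun setT (f \o rho) <-> measurable_fun setT f.
Proof.
split=> mf; last exact: measurableT_comp.
have -> : f = (f \o rho) \o (fun x : G => x * g^-1)%g.
  by apply/funext => x /=; rewrite /rho -mulgA mulVg mulg1.
by apply: measurableT_comp => //; exact: measurable_rmul.
Qed.

Lemma integrable_rmulE (f : B -> R) :
  mu.-integrable setT (EFin \o (f \o rho)) <-> mu.-integrable setT (EFin \o f).
Proof.
have h : measurable_fun setT f ->
    (\int[mu]_x `|(f (rho x))%:E| = k%:E * \int[mu]_x `|(f x)%:E|)%E.
  move=> mf; rewrite -ge0_integral_rmul//.
  by apply: measurableT_comp => //; exact/measurable_EFinP.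
split=> /integrableP[/measurable_EFinP mf foo].
  have {}mf := (measurable_fun_rmulE f).1 mf.
  apply/integrableP; split; first exact/measurable_EFinP.
  move: foo; rewrite /= h// !ltey; apply: contra => /eqP ->.
  by rewrite gt0_muley.
apply/integrableP; split; first exact/measurable_EFinP/measurable_fun_rmulE.
rewrite /= h//; apply: lte_mul_pinfty => //; first by rewrite lee_fin ltW.
Qed.

Lemma cintegrable_rmulE (f : B -> R[i]^o) :
  cintegrable mu (fun x => f (rho x)) <-> cintegrable mu f.
Proof.
rewrite /cintegrable.
have := integrable_rmulE (fun x => complex.Re (f x)).
have := integrable_rmulE (fun x => complex.Im (f x)).
by rewrite /comp => -> ->.
Qed.

Let kC : R[i] := (k^-1)%:C.

Let kC_neq0 : kC != 0.
Proof. by rewrite /kC eq_complex /= negb_and invr_eq0 gt_eqF. Qed.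

(** The equivalence ensures that a convolution and its translate fall back on the default value of
    [insubd] simultaneously. *)
Lemma cintegrable_scale_rmulE (f : B -> R[i]^o) :
  cintegrable mu (fun x => kC * f (rho x)) <-> cintegrable mu f.
Proof. by rewrite (cintegrableZE _ _ kC_neq0) cintegrable_rmulE. Qed.

(* Right convolution by a point mass, rescaled by [k^-1] to be isometric. *)
Definition rtransl_fun (f : l1fun mu) : l1fun mu :=
  mk_l1fun ((cintegrable_scale_rmulE f).2 (l1funP f)).

Definition rtransl (f : L1 mu) : L1 mu := \pi_(L1 mu) (rtransl_fun (repr f)).

Lemma rtransl_pi (f : l1fun mu) :
  rtransl (\pi_(L1 mu) f) = \pi_(L1 mu) (rtransl_fun f).
Proof.
apply/L1_eqP; have := ae_rmul (repr_piE f).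
by apply: filterS => x /= ->.
Qed.

Lemma rtransl_linear : linear rtransl.
Proof.
move=> a f h; rewrite -[f]reprK -[h]reprK.
rewrite -[a *: _]/(L1_scale a _) L1_scale_pi -L1_piD !rtransl_pi.
rewrite -[a *: _]/(L1_scale a _) L1_scale_pi -L1_piD.
apply/L1_eqP; apply: aeW => x.
by rewrite /= !fctE /= mulrDr; congr (_ + _); exact: mulrCA.
Qed.

HB.instance Definition _ := GRing.isLinear.Build R[i] (L1 mu) (L1 mu) _ rtransl
  rtransl_linear.

Lemma rtransl_norm (f : L1 mu) : `|rtransl f| = `|f|.
Proof.
rewrite -[f]reprK rtransl_pi !L1_normE !L1_norm_pi; congr (_ %:C).
rewrite /Rintegral /=; congr fine.
under eq_integral do rewrite normcM EFinM.
pose h x := (normc (repr f x))%:E.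
have mh : measurable_fun setT h.
  exact: measurable_int (integrable_normc (l1funP (repr f))).
have h0 x : (0 <= h x)%E by rewrite lee_fin normc_ge0.
rewrite ge0_integralZl ?lee_fin ?normc_ge0//; last 2 first.
- exact: (measurableT_comp mh mrho).
- by move=> x _; rewrite lee_fin normc_ge0.
rewrite (ge0_integral_rmul mh h0) muleA -EFinM.
have -> : normc kC = k^-1.
  by rewrite /= expr0n addr0 sqrtr_sqr ger0_norm// invr_ge0 ltW.
by rewrite mulVf ?gt_eqF// mul1e.
Qed.

End RightTranslation.

(** * Integrable functions are carried by sigma-compact sets *)

Section Convolution.
Context (R : realType) (G : topologicalGroupType).
Local Notation B := (borelType G).
Variable mu : {measure set B -> \bar R}.
Hypothesis hG : hausdorff_space G.
Hypothesis lcG : locally_compact [set: G].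
Hypothesis haar_mu : left_haar_measure mu.

Lemma l1fun_measurable_Re (f : l1fun mu) :
  measurable_fun setT (fun x => complex.Re (f x)).
Proof. by have [/measurable_int/measurable_EFinP] := l1funP f. Qed.

Lemma l1fun_measurable_Im (f : l1fun mu) :
  measurable_fun setT (fun x => complex.Im (f x)).
Proof. by have [_ /measurable_int/measurable_EFinP] := l1funP f. Qed.

(** Compact subsets of [U] with measure within [1/(m+1)] of the finite number [mu U] exhaust it up
    to a null set. *)
Lemma haar_sigma_compact_inner (U : set G) : open U -> (mu U < +oo)%E ->
  exists K : nat -> set G, (forall m, compact (K m)) /\
    mu (U `\` \bigcup_m K m) = 0%E.
Proof.
move=> oU Uoo.
have Ufin : mu U \is a fin_num by rewrite ge0_fin_numE.
have /choice[K KP] (m : nat) : exists K : set G,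
    [/\ compact K, K `<=` U & (mu U - (m.+1%:R^-1)%:E < mu K)%E].
  have := haar_open_sup haar_mu oU; set S := [set mu K | K in _] => US.
  have Sfin : ereal_sup S \is a fin_num by rewrite -US.
  have m0 : (0 < m.+1%:R^-1 :> R) by rewrite invr_gt0.
  have [_ [K [cK KU] <-] UK] := ub_ereal_sup_adherent m0 Sfin.
  by exists K; split => //; rewrite US.
exists K; split=> [m|]; first by have [] := KP m.
have mK m : measurable (K m : set B).
  by apply: compact_borel => //; have [] := KP m.
have mU := open_borel oU.
have mUK : measurable (U `\` \bigcup_m K m : set B).
  by apply: measurableD => //; exact: bigcupT_measurable.
apply/eqP; rewrite -measure_le0; apply/lee_addgt0Pr => e e0; rewrite add0e.
have [m me] : exists m, (m.+1%:R^-1 <= e).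
  exists (Num.truncn e^-1); rewrite -[leRHS]invrK lef_pV2 ?posrE ?invr_gt0//.
  by rewrite ltW// truncnS_gt.
apply: (@le_trans _ _ (mu (U `\` K m))).
  apply: le_measure; rewrite ?inE//; first exact: measurableD.
  by apply: setDS; exact: bigcup_sup.
have [_ KU UK] := KP m.
rewrite measureD//.
have -> : U `&` K m = K m by rewrite setIC; exact/setIidPl.
have Kfin : mu (K m) \is a fin_num.
  rewrite ge0_fin_numE//; apply: le_lt_trans Uoo.
  by apply: le_measure; rewrite ?inE.
apply: (@le_trans _ _ (m.+1%:R^-1)%:E); last by rewrite lee_fin.
by rewrite leeBlDr// addeC; move: UK; rewrite lteBlDr// => /ltW.
Qed.

(** The level sets [E n] where the modulus of [f] is at least [1/(n+1)] have finite measure by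
    Markov's inequality. Each lies in an open set of finite measure, hence in a sigma-compact set up
    to a null set. *)
Lemma l1fun_sigma_compact (f : l1fun mu) : exists K : nat -> set G,
  (forall m, compact (K m)) /\
  \forall y \ae mu, (forall m, ~ K m y) -> f y = 0.
Proof.
pose h y := normc (f y).
have ih := integrable_normc (l1funP f).
have mh : measurable_fun setT h 
  by apply/measurable_EFinP; exact: measurable_int ih.
pose E (n : nat) : set B := setT `&` [set y | (n.+1%:R^-1)%:E <= `|(h y)%:E|]%E.
have mE n : measurable (E n).
  have -> : E n = setT `&` h @^-1` `[n.+1%:R^-1, +oo[%classic.
    rewrite /E; congr (_ `&` _); apply/seteqP; split => y /=;
      by rewrite in_itv/= andbT lee_fin ger0_norm// normc_ge0.
  exact: mh.
have Eoo n : (mu (E n) < +oo)%E.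
  have n0 : (0 < n.+1%:R^-1 :> R) by rewrite invr_gt0.
  have := le_integral_abse mu measurableT (measurable_int mu ih) n0.
  have /integrableP[_ ioo] := ih => /le_lt_trans/(_ ioo).
  rewrite -/(E n) => Elt; rewrite ltey; apply/eqP => Einf.
  by move: Elt; rewrite Einf gt0_muley ?lte_fin.
have /choice[U UP] n : exists U : set G,
    [/\ open U, E n `<=` U & (mu U < +oo)%E].
  have [U [oU EU Ule]] := haar_outer haar_mu (mE n) (Eoo n) (@ltr01 R).
  exists U; split => //; apply: le_lt_trans Ule _.
  by rewrite lte_add_pinfty// ltry.
have /choice[K KP] n : exists K : nat -> set G, (forall m, compact (K m)) /\
    mu (U n `\` \bigcup_m K m) = 0%E.
  by have [oU _ Uoo] := UP n; exact: haar_sigma_compact_inner.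
(* The doubly indexed family becomes a sequence; an index coding no pair merely repeats [K 0 0]. *)
pose K' (i : nat) := let p := odflt (0, 0)%N (choice.unpickle i) in K p.1 p.2.
exists K'; split=> [i|].
  by have [cK _] := KP (odflt (0, 0)%N (choice.unpickle i)).1; exact: cK.
have mZ n : measurable (U n `\` \bigcup_m K n m : set B).
  apply: measurableD; first by apply: open_borel; have [] := UP n.
  apply: bigcupT_measurable => m; apply: compact_borel => //.
  by have [cK _] := KP n; exact: cK.
have : mu.-negligible (\bigcup_n (U n `\` \bigcup_m K n m)).
  by apply: negligible_bigcup => n; apply/negligibleP => //; have [] := KP n.
apply: negligibleS => y /= /not_implyP[nK fy0].
have /eqP hy0 : h y != 0 by apply/eqP => /eq0_normc.
have hy : 0 < h y by rewrite lt_neqAle normc_ge0 eq_sym andbT; exact/eqP.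
(* For this [n] one has [1/(n+1) <= h y], so [y] belongs to [E n]. *)
exists (Num.truncn (h y)^-1) => //; split; last first.
  move=> [m _ Ky]; apply: (nK (choice.pickle (Num.truncn (h y)^-1, m))).
  by rewrite /K' choice.pickleK.
have [_ + _] := UP (Num.truncn (h y)^-1); apply; split => //=.
rewrite lee_fin ger0_norm ?normc_ge0// -[leRHS]invrK lef_pV2 ?posrE ?invr_gt0//.
by rewrite ltW// truncnS_gt.
Qed.

End Convolution.

(** * Right translation commutes with left convolution *)

Section ConvolutionTranslation.
Context (R : realType) (G : topologicalGroupType).
Local Notation B := (borelType G).
Variable mu : {measure set B -> \bar R}.
Hypothesis hG : hausdorff_space G.
Hypothesis lcG : locally_compact [set: G].
Hypothesis haar_mu : left_haar_measure mu.

Lemma ReM (a b : R[i]) : complex.Re (a * b) =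
  complex.Re a * complex.Re b - complex.Im a * complex.Im b.
Proof. by case: a b => [? ?] [? ?]. Qed.

Lemma ImM (a b : R[i]) : complex.Im (a * b) =
  complex.Re a * complex.Im b + complex.Im a * complex.Re b.
Proof. by case: a b => [? ?] [? ?]. Qed.

Let inv_mul (x : G) : B -> B := fun y : G => (y^-1 * x)%g.

Let measurable_inv_mul (x : G) : measurable_fun setT (inv_mul x).
Proof.
apply: continuous_borel => y; apply: mul_cvg; last exact: cvg_cst.
exact: invg_continuous.
Qed.

Lemma measurable_convolution_integrand (f g : l1fun mu) (x : G) :
  measurable_fun setT
    (fun y : B => complex.Re (f y * g ((y : G)^-1 * x)%g)) /\
  measurable_fun setT
    (fun y : B => complex.Im (f y * g ((y : G)^-1 * x)%g)).
Proof.
have mfr := l1fun_measurable_Re f; have mfi := l1fun_measurable_Im f.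
have mgr := measurableT_comp (l1fun_measurable_Re g) (measurable_inv_mul x).
have mgi := measurableT_comp (l1fun_measurable_Im g) (measurable_inv_mul x).
split; [under eq_fun do rewrite ReM|under eq_fun do rewrite ImM].
  by apply: measurable_funB; apply: measurable_funM.
by apply: measurable_funD; apply: measurable_funM.
Qed.

(* [y |-> y^-1 x] need not pull null sets back to null sets a priori, but it
   does so inside the sigma-compact set carrying [f]. *)
Lemma convolution_integrand_ae (f g1 g2 : l1fun mu) (x : G) :
  (\forall z \ae mu, g1 z = g2 z) ->
  \forall y \ae mu, f y * g1 ((y : G)^-1 * x)%g = f y * g2 ((y : G)^-1 * x)%g.
Proof.
move=> [N [mN N0 Nsub]].
have [K [cK fK]] := l1fun_sigma_compact hG haar_mu f.
pose C m := [set (p.1 * p.2)%g | p in [set y^-1%g | y in K m] `*` [set x]].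
have cC m : compact (C m).
  by apply: compact_mul; [exact: compact_inv|exact: compact_set1].
(* Since [(x^-1 y)^-1 = y^-1 x], this is a left translate of the inverse of a null subset of the
   compact set [C m]; it contains the exceptional points of [K m]. *)
pose Z m : set B := (fun y : G => (x^-1 * y)%g) @^-1`
  ((fun z : G => z^-1%g) @^-1` (N `&` C m)).
have mNC m : measurable (N `&` C m : set B).
  by apply: measurableI => //; exact: compact_borel.
have Z0 m : mu.-negligible (Z m).
  apply/negligibleP; first by apply: measurable_lmul; exact: measurable_invset.
  apply: etrans (haar_left_invariant haar_mu _ (measurable_invset (mNC m))) _.
  apply: (haar_inv_null hG lcG haar_mu (cC m)) => //.
  apply/eqP; rewrite -measure_le0 -N0; apply: le_measure; rewrite ?inE//.
have {}Z0 := negligible_bigcup Z0.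
have Zae : \forall y \ae mu, ~ (\bigcup_m Z m) y.
  by apply: negligibleS Z0 => y /= /contrapT.
have FF : Filter (almost_everywhere mu) := ae_filter_ringOfSetsType mu.
apply: filterS2 fK Zae => y fy0 nZ.
have [[m Km]|nK] := pselect (exists m, K m y); last first.
  by rewrite fy0 ?mul0r// => m Km; apply: nK; exists m.
have [->//|ne] := pselect (g1 ((y : G)^-1 * x)%g = g2 ((y : G)^-1 * x)%g).
exfalso; apply: nZ; exists m => //; rewrite /Z /= invgM invgK; split.
  exact: Nsub.
by exists (y^-1%g, x) => //; split => //; exists y.
Qed.

(** For every [x] the two integrands agree almost everywhere, so the convolutions agree at every
    point and are integrable or not together. *)
Lemma convolution_fun_ae (f g1 g2 : l1fun mu) :
  (\forall z \ae mu, g1 z = g2 z) ->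
  convolution_fun mu f g1 = convolution_fun mu f g2.
Proof.
move=> g12; apply/funext => x; rewrite /convolution_fun /cintegral.
have h := convolution_integrand_ae f x g12.
have [mr1 mi1] := measurable_convolution_integrand f g1 x.
have [mr2 mi2] := measurable_convolution_integrand f g2 x.
congr (_ +i* _); congr fine; apply: ae_eq_integral => //;
  try exact/measurable_EFinP; by apply: filterS h => y /= ->.
Qed.

Lemma cintegralZ (c : R) (F : B -> R[i]^o) : 0 < c ->
  measurable_fun setT (fun y => complex.Re (F y)) ->
  measurable_fun setT (fun y => complex.Im (F y)) ->
  cintegral mu (fun y => c%:C * F y) = c%:C * cintegral mu F.
Proof.
move=> c0 mr mi; rewrite /cintegral.
transitivity ((c * (\int[mu]_y complex.Re (F y))) +i*
    (c * (\int[mu]_y complex.Im (F y))))%C; last first.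
  by rewrite /GRing.mul /= !mul0r subr0 addr0.
rewrite -!measurable_Rintegral_pZl//; congr (_ +i* _)%C;
  apply: eq_Rintegral => y _; case: (F y) => a b /=;
  by rewrite mul0r ?subr0 ?addr0.
Qed.

Variables (g : G) (k : R).
Hypothesis k_gt0 : 0 < k.
Hypothesis mu_rmul : forall A : set B, measurable A ->
  (mu ((fun x : G => (x * g)%g) @^-1` A) = k%:E * mu A)%E.

Local Notation tr := (rtransl_fun k_gt0 mu_rmul).
Local Notation Tr := (rtransl k_gt0 mu_rmul).

Lemma convolution_fun_rtransl (f h : l1fun mu) :
  convolution_fun mu f (tr h) =
  (fun x => (k^-1)%:C * convolution_fun mu f h (x * g)%g).
Proof.
apply/funext => x; rewrite /convolution_fun.
have [mr mi] := measurable_convolution_integrand f h (x * g)%g.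
rewrite -cintegralZ ?invr_gt0//; congr cintegral; apply/funext => y /=.
by rewrite mulrCA mulgA.
Qed.

Lemma rtransl_convolution (f h : L1 mu) :
  Tr (L1_convolution f h) = L1_convolution f (Tr h).
Proof.
rewrite /L1_convolution rtransl_pi.
rewrite (convolution_fun_ae (repr f) (repr_piE (tr (repr h)))).
rewrite convolution_fun_rtransl.
set F := convolution_fun mu (repr f) (repr h).
have trE := cintegrable_scale_rmulE k_gt0 mu_rmul F.
have [Fi|nFi] := pselect (cintegrable mu F).
  apply/L1_eqP; apply: aeW => x.
  rewrite /= !insubdK//; apply/asboolP => //.
  exact/trE.
(* Without integrability both sides are the class of the default value 0. *)
have -> : insubd (0 : l1fun mu) F = 0.
  by apply/val_inj; rewrite val_insubd ifN//; apply/asboolP.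
rewrite (_ : insubd _ _ = 0); last first.
  apply/val_inj; rewrite val_insubd ifN//; apply/asboolP.
  by apply: contra_not nFi => /trE.
by apply/L1_eqP; apply: aeW => x; rewrite /= mulr0.
Qed.

(** Kept transparent so that the underlying map reduces to [Tr]. *)
Definition rtransl_multiplier : right_multiplier (@L1_convolution R G mu).
Proof.
apply: (@RightMultiplier _ _ _ Tr).
  by exists 1 => x; rewrite mul1r rtransl_norm.
exact: rtransl_convolution.
Defined.

End ConvolutionTranslation.

(** * Disjoint supports in [L1 mu] and linear spans *)

Section L1Lemmas.
Context d (T : measurableType d) (R : realType).
Variable mu : {measure set T -> \bar R}.
Implicit Types f h : L1 mu.

Let ae_filter : Filter (almost_everywhere mu) := ae_filter_ringOfSetsType mu.

Lemma L1_reprD f h : \forall t \ae mu, repr (f + h) t = repr f t + repr h t.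
Proof.
have -> : f + h = \pi_(L1 mu) (repr f + repr h) by rewrite L1_piD !reprK.
exact: repr_piE.
Qed.

Lemma L1_reprZ (a : R[i]) f : \forall t \ae mu, repr (a *: f) t = a * repr f t.
Proof. exact: (repr_piE (a *: repr f)). Qed.

Lemma L1_repr0 : \forall t \ae mu, repr (0 : L1 mu) t = 0.
Proof.
have -> : (0 : L1 mu) = \pi_(L1 mu) 0 by rewrite pi_zeror.
by apply: filterS (repr_piE 0) => t ->.
Qed.

Lemma L1_eq0 f : (\forall t \ae mu, repr f t = 0) -> f = 0.
Proof.
move=> f0; rewrite -[f]reprK -[0]reprK; apply/L1_eqP.
by apply: filterS2 f0 L1_repr0 => t -> ->.
Qed.

Definition L1_disjoint f h := \forall t \ae mu, repr f t = 0 \/ repr h t = 0.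

Lemma L1_disjoint0 f : L1_disjoint f 0.
Proof. by apply: filterS L1_repr0 => t ->; right. Qed.

Lemma L1_disjointD f h1 h2 :
  L1_disjoint f h1 -> L1_disjoint f h2 -> L1_disjoint f (h1 + h2).
Proof.
move=> d1 d2; apply: filterS3 d1 d2 (L1_reprD h1 h2) => t + + ->.
by move=> [|h10]; [left|move=> [|h20]; [left|right; rewrite h10 h20 addr0]].
Qed.

Lemma L1_norm_disjointD f h : L1_disjoint f h -> `|f + h| = `|f| + `|h|.
Proof.
move=> fh; rewrite !L1_normE /L1_norm -rmorphD; congr (_ %:C).
have intf := integrable_normc (l1funP (repr f)).
have inth := integrable_normc (l1funP (repr h)).
rewrite -RintegralD//; congr fine; apply: ae_eq_integral => //.
- exact: measurable_int (integrable_normc (l1funP _)).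
- exact: measurable_int (integrableD measurableT intf inth).
apply: filterS2 fh (L1_reprD f h) => t + -> _.
have n0 : normc (0 : R[i]) = 0 by rewrite /= expr0n addr0 sqrtr0.
by move=> [->|->]; rewrite ?add0r ?addr0 n0 ?add0r ?addr0.
Qed.

Lemma L1_norm_disjoint_sum (p : nat) (x : 'I_p -> L1 mu) :
  (forall n m, n != m -> L1_disjoint (x n) (x m)) ->
  `|\sum_n x n| = \sum_n `|x n|.
Proof.
move=> xd; elim: index_enum (index_enum_uniq 'I_p) => [|n s IH] /=.
  by rewrite !big_nil normr0.
move=> /andP[ns us]; rewrite !big_cons -IH//; apply: L1_norm_disjointD.
rewrite big_seq; apply: (big_ind (L1_disjoint (x n))).
- exact: L1_disjoint0.
- by move=> *; exact: L1_disjointD.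
- by move=> m ms; apply: xd; apply: contraNneq ns => ->.
Qed.

End L1Lemmas.

Section LinSpan.
Context (K : numFieldType) (A : normedModType K).

Lemma lin_span_ind (E P : set A) : P 0 -> (forall a x, P x -> P (a *: x)) ->
  (forall x y, P x -> P y -> P (x + y)) -> E `<=` P -> lin_span E `<=` P.
Proof.
move=> P0 PZ PD EP _ [n [c [e [Ee ->]]]].
by apply: big_ind => // i _; apply: PZ; exact: EP.
Qed.

Lemma lin_span_image (f : {linear A -> A}) (E : set A) :
  lin_span (f @` E) `<=` f @` lin_span E.
Proof.
move=> _ [n [c [e [Ee ->]]]].
have /choice[y yP] i : exists x, E x /\ f x = e i by have [x] := Ee i; exists x.
exists (\sum_i c i *: y i).
  by exists n, c, y; split => // i; have [] := yP i.
rewrite linear_sum; apply: eq_bigr => i _; rewrite linearZ.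
by have [_ ->] := yP i.
Qed.

Lemma lin_span_normalize (E : set A) (x : A) :
  E ((`|x| + 1)^-1 *: x) -> lin_span E x.
Proof.
(* The summand 1 keeps the scalar invertible when [x = 0]. *)
move=> Ex; exists 1%N, (fun=> `|x| + 1), (fun=> (`|x| + 1)^-1 *: x).
split => //.
by rewrite big_ord1 scalerA mulfV ?scale1r// gt_eqF// ltr_wpDl.
Qed.

End LinSpan.

Lemma seq_upper_bound d (I : orderType d) (i0 : I) (s : seq I) :
  exists a, forall i, i \in s -> (i <= a)%O.
Proof.
elim: s => [|j s [a ha]]; first by exists i0.
exists (Order.max a j) => i; rewrite in_cons => /orP[/eqP ->|/ha ia].
  by rewrite le_max lexx orbT.
by rewrite le_max ia.
Qed.

(** * Approximation by truncation to an increasing sequence of sets *)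

Section Truncation.
Context d (T : measurableType d) (R : realType).
Variable mu : {measure set T -> \bar R}.

Lemma cintegrable_indic (F : set T) (f : T -> R[i]^o) : measurable F ->
  cintegrable mu f -> cintegrable mu (fun t => (\1_F t)%:C * f t).
Proof.
move=> mF [fr fi].
have h (u : T -> R) : mu.-integrable setT (EFin \o u) ->
    mu.-integrable setT (EFin \o (fun t => \1_F t * u t)).
  move=> ui; apply: (le_integrable _ _ _ ui) => //.
    apply/measurable_EFinP.
    apply: measurable_funM; first exact: measurable_indic.
    by apply/measurable_EFinP; exact: measurable_int ui.
  move=> t _ /=; rewrite lee_fin normrM ler_piMl// indicE.
  by case: (_ \in _); rewrite ?normr1 ?normr0.
split; [have := h _ fr|have := h _ fi]; apply: eq_integrable => // t _ /=;
  by case: (f t) => a b /=; rewrite mul0r ?subr0 ?addr0.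
Qed.

(** Dominated convergence: the modulus of [f] bounds the errors, which tend to zero almost
    everywhere. *)
Lemma L1_truncation_approx (f : l1fun mu) (F : nat -> set T) (e : R) : 0 < e ->
  (forall n, measurable (F n)) -> nondecreasing_seq F ->
  (\forall t \ae mu, (forall n, ~ F n t) -> f t = 0) ->
  exists n, \int[mu]_t normc (f t - (\1_(F n) t)%:C * f t) < e.
Proof.
move=> e0 mF ndF fF.
have intf := integrable_normc (l1funP f).
pose u n t : \bar R := (normc (f t - (\1_(F n) t)%:C * f t))%:E.
have uE n t : u n t = (\1_(~` F n) t * normc (f t))%:E.
  rewrite /u -{1}[f t]mul1r -mulrBl normcM indicC !indicE; congr (_ * _)%:E.
  case: (_ \in _); rewrite /= ?subrr ?subr0 /=;
  by rewrite ?expr0n ?expr1n ?addr0 ?sqrtr0 ?sqrtr1.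
have mu_ n : measurable_fun setT (u n).
  apply: (eq_measurable_fun (fun t => (\1_(~` F n) t * normc (f t))%:E)).
    by move=> t _; rewrite uE.
  apply/measurable_EFinP; apply: measurable_funM.
    by apply: measurable_indic; exact: measurableC.
  by apply/measurable_EFinP; exact: measurable_int intf.
have u0 n t : (0 <= u n t)%E by rewrite lee_fin normc_ge0.
have FF : Filter (almost_everywhere mu) := ae_filter_ringOfSetsType mu.
have [] := @dominated_convergence _ _ _ mu setT measurableT u (cst 0%E)
  (EFin \o (fun t => normc (f t))) mu_ _ _ intf.
- exact: measurable_cst.
- apply: filterS fF => t ft _.
  have [[n Fnt]|nF] := pselect (exists n, F n t); last first.
    have -> : u^~ t = cst 0%E; last exact: cvg_cst.
    apply/funext => n; rewrite uE ft ?mulr0; last first.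
      by move=> m Fm; apply: nF; exists m.
    by rewrite /= expr0n addr0 sqrtr0 mulr0.
  (* As [F] increases, the error at [t] is zero from the first [n] found with [F n t] onwards. *)
  apply: (cvg_near_cst _); exists n => // m /= nm.
  rewrite uE indicE memNset ?mul0r//; apply; move: t Fnt {ft}.
  exact/subsetPset/ndF.
- apply: aeW => t n _; rewrite gee0_abs// uE lee_fin ler_piMl ?normc_ge0//.
move=> _ _ /= ; rewrite integral0 => /fine_cvgP[_].
move=> /cvgrPdist_lt/(_ _ e0)[n _ /(_ n (leqnn n))] /=.
rewrite sub0r normrN ger0_norm; first by exists n.
by apply: fine_ge0; exact: integral_ge0.
Qed.

End Truncation.

(** * The base built from the compact family and the translates *)

Section Main.
Context (R : realType) (G : topologicalGroupType).
Local Notation B := (borelType G).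
Variable mu : {measure set B -> \bar R}.
Context (d : Order.disp_t) (eta : orderType d).
Hypothesis hG : hausdorff_space G.
Hypothesis lcG : locally_compact [set: G].
Hypothesis haar_mu : left_haar_measure mu.
Variable C : eta -> set G.
Hypothesis cC : forall i, compact (C i).
Hypothesis cover_C : forall K, compact K ->
  exists s : seq eta, K `<=` \bigcup_(i in [set` s]) C i.

Let ae_filter : Filter (almost_everywhere mu) := ae_filter_ringOfSetsType mu.
#[local] Existing Instance ae_filter.

(* Finite unions of the [C i] are used rather than the union of all [C i] with
   [i <= a], which need not be measurable. *)
Definition supported_below (a : eta) : set (L1 mu) := [set f : L1 mu |
  exists2 s : seq eta, (forall i, i \in s -> (i <= a)%O) &
    \forall t \ae mu, (forall i, i \in s -> ~ C i t) -> repr f t = 0].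

Lemma supported_below0 a : supported_below a 0.
Proof. by exists [::] => //; apply: filterS (L1_repr0 mu) => t ->. Qed.

Lemma supported_belowZ a (c : R[i]) f :
  supported_below a f -> supported_below a (c *: f).
Proof.
move=> [s sa sf]; exists s => //.
apply: filterS2 sf (L1_reprZ c f) => t ft -> nC.
by rewrite ft// mulr0.
Qed.

Lemma supported_belowD a f h :
  supported_below a f -> supported_below a h -> supported_below a (f + h).
Proof.
move=> [s sa sf] [s' s'a s'h]; exists (s ++ s').
  by move=> i; rewrite mem_cat => /orP[/sa|/s'a].
apply: filterS3 sf s'h (L1_reprD f h) => t ft ht -> nC.
rewrite ft ?ht ?addr0// => i si; apply: nC; rewrite mem_cat si ?orbT//.
Qed.

Lemma supported_below_le a b : (a <= b)%O ->
  supported_below a `<=` supported_below b.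
Proof. by move=> ab f [s sa sf]; exists s => // i /sa /le_trans; exact. Qed.

Definition ball_below (a : eta) : set (L1 mu) :=
  [set f : L1 mu | `|f| <= 1 /\ supported_below a f].

Lemma lin_span_ball_below a : lin_span (ball_below a) `<=` supported_below a.
Proof.
apply: lin_span_ind => [|c f|f h|f []//].
- exact: supported_below0.
- exact: supported_belowZ.
- exact: supported_belowD.
Qed.

Lemma supported_below_lin_span a :
  supported_below a `<=` lin_span (ball_below a).
Proof.
move=> f fa; apply: lin_span_normalize; split; last exact: supported_belowZ.
have f1 : 0 < `|f| + 1 by rewrite ltr_wpDl.
rewrite normrZ ger0_norm ?invr_ge0 ?addr_ge0// mulrC.
by rewrite ler_pdivrMr// mul1r lerDl.
Qed.

(** [f] is carried by countably many compact sets, each inside finitely many [C i]. A truncation of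
    [f] thus involves finitely many indices, which have an upper bound in [eta]. *)
Lemma exists_supported_approx (f : L1 mu) (e : R) : 0 < e ->
  exists a h, supported_below a h /\ `|f - h| < e%:C.
Proof.
move=> e0.
have [K [cK fK]] := l1fun_sigma_compact hG haar_mu (repr f).
have /choice[s sK] m := cover_C (cK m).
(* Covering one point provides an element of [eta], the upper bound in case the list of indices is
   empty. *)
have [s1 s1P] := cover_C (@compact_set1 G 1%g).
have [i0 _ _] := s1P _ erefl.
(* Accumulating the lists up to [n] makes the sets [F n] increasing. *)
pose S n := flatten [seq s m | m <- iota 0 n.+1].
pose F n : set B := \bigcup_(i in [set` S n]) C i.
have mF n : measurable (F n).
  rewrite /F bigcup_seq; apply: bigsetU_measurable => i _.
  exact: compact_borel.
have ndF : nondecreasing_seq F.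
  move=> n m nm; apply/subsetPset; apply: bigcup_subset => i /=.
  move=> /flatten_mapP[j + sj]; rewrite mem_iota add0n => /andP[_ jn].
  apply/flatten_mapP; exists j => //; rewrite mem_iota add0n /=.
  exact: leq_trans jn _.
have fF : \forall t \ae mu, (forall n, ~ F n t) -> repr f t = 0.
  apply: filterS fK => t + nF; apply => m /sK[i si Cit].
  apply: (nF m); exists i => //=; apply/flatten_mapP; exists m => //.
  by rewrite mem_iota add0n /=.
have [n fn] := L1_truncation_approx e0 mF ndF fF.
have [a aS] := seq_upper_bound i0 (S n).
pose h := mk_l1fun (cintegrable_indic (mF n) (l1funP (repr f))).
exists a, (\pi_(L1 mu) h); split.
  exists (S n) => //; apply: filterS (repr_piE h) => t -> nC.
  rewrite /= indicE memNset ?mul0r// => -[i Si Cit].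
  exact: nC Si Cit.
have -> : f - \pi_(L1 mu) h = \pi_(L1 mu) (repr f - h).
  by rewrite pi_addr pi_oppr reprK.
by rewrite L1_normE L1_norm_pi ltcR.
Qed.

Lemma dense_ball_below :
  closure (lin_span (\bigcup_a ball_below a)) = [set: L1 mu].
Proof.
apply/seteqP; split=> // f _ V /nbhs_ballP[e /= e0 eV].
(* Norms take values in [R[i]], where a positive element has zero imaginary part. *)
have eE : e = (complex.Re e)%:C.
  by move: e0; rewrite ltcE => /andP[/eqP e0 _]; case: e e0 {eV} => a b /= ->.
have re0 : 0 < complex.Re e by move: e0; rewrite eE ltcR.
have [a [h [ha fh]]] := exists_supported_approx f re0.
exists h; split; last by apply: eV; rewrite -ball_normE /ball_/= eE.
have [n [c [x [xa ->]]]] := supported_below_lin_span ha.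
by exists n, c, x; split => // i; exists a.
Qed.

Variable x : eta -> G.
Hypothesis disjoint_x : forall a b i j u v, (b < a)%O -> (i <= a)%O ->
  (j <= b)%O -> C i u -> C j v -> (u * x a)%g <> (v * x b)%g.
Variable k : eta -> R.
Hypothesis k_gt0 : forall a, 0 < k a.
Hypothesis mu_rmul : forall a (A : set B), measurable A ->
  (mu ((fun t : G => (t * (x a)^-1)%g) @^-1` A) = (k a)%:E * mu A)%E.

(** The argument is multiplied by [(x a)^-1], so a function carried by [C i] is moved to one carried
    by [C i] times [x a]. *)
Let mult a := rtransl_multiplier hG lcG haar_mu (k_gt0 a) (@mu_rmul a).

Let mult_norm a f : `|mult a f| = `|f|.
Proof. exact: rtransl_norm. Qed.

Let mult_support a f : supported_below a f ->
  \forall t \ae mu, repr (mult a f) t = 0 \/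
    exists i u, [/\ (i <= a)%O, C i u & t = (u * x a)%g].
Proof.
move=> [s sa fs].
have h1 := repr_piE (rtransl_fun (k_gt0 a) (@mu_rmul a) (repr f)).
have h2 := ae_rmul (@mu_rmul a) fs.
apply: filterS2 h1 h2 => t -> /= ft.
have [[i si Ci]|nC] := pselect (exists2 i, i \in s & C i (t * (x a)^-1)%g).
  right; exists i, (t * (x a)^-1)%g; split; [exact: sa|exact: Ci|].
  by rewrite -mulgA mulVg mulg1.
by left; rewrite ft ?mulr0// => i si Ci; apply: nC; exists i.
Qed.

Let mult_disjoint a b f h : a != b -> supported_below a f ->
  supported_below b h -> L1_disjoint (mult a f) (mult b h).
Proof.
move=> ab /mult_support fa /mult_support hb.
apply: filterS2 fa hb => t [|[i [u [ia Cu tu]]]]; first by left.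
move=> [|[j [v [jb Cv tv]]]]; first by right.
exfalso; move: ab; rewrite neq_lt => /orP[ab|ba].
  by apply: (disjoint_x ab jb ia Cv Cu); rewrite -tu -tv.
by apply: (disjoint_x ba ia jb Cu Cv); rewrite -tu -tv.
Qed.

Let span_mult a y : lin_span (mult a @` ball_below a) y ->
  exists2 f, supported_below a f & y = mult a f.
Proof.
move=> /lin_span_image[f fa <-]; exists f => //.
exact: lin_span_ball_below.
Qed.

Lemma fl1_base2_translates :
  fl1_base2_data ball_below mult (\bigcup_a (mult a @` ball_below a)).
Proof.
split => //.
- by move=> a b ab f [f1 fa]; split => //; exact: supported_below_le fa.
- by move=> f [a _ []].
- exact: dense_ball_below.
- by exists 1 => a f; rewrite mul1r mult_norm.
(* An element common to both spans is disjoint from itself, hence zero. *)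
- move=> a b ab; apply/seteqP; split=> [y [ya yb]|_ ->] /=.
    have [f fa yf] := span_mult ya; have [h hb yh] := span_mult yb.
    apply: L1_eq0; have := mult_disjoint ab fa hb; rewrite -yf -yh.
    by apply: filterS => t [].
  split; exists 0%N, (fun=> 0), (fun=> 0); split => [[]//|];
  by rewrite big_ord0.
(* The norm is additive on disjointly supported elements, so the constant is 1 and equality
   holds. *)
- exists 1 => // p alpha y inj_alpha ya; rewrite mul1r.
  rewrite L1_norm_disjoint_sum// => n m nm.
  have [f fa ->] := span_mult (ya n); have [h hb ->] := span_mult (ya m).
  by apply: mult_disjoint => //; apply: contraNneq nm => /inj_alpha ->.
- by exists 1 => // a f _; rewrite mul1r mult_norm.
Qed.

End Main.

Theorem theorem6p1 (R : realType) (G : topologicalGroupType)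
    (mu : {measure set (borelType G) -> \bar R})
    (d : Order.disp_t) (eta : orderType d) :
  hausdorff_space G ->
  locally_compact [set: G] ->
  ~ compact [set: G] ->
  left_haar_measure mu ->
  initial_ordinal eta ->
  is_compact_covering_number G eta ->
  exists L : set (L1 mu), fl1_base_type2 (@L1_convolution R G mu) eta L.
Proof.
move=> hG lcG ncG haar_mu ord_eta cov_eta.
have [C [cC cover_C]] := exists_compact_family lcG cov_eta.
have [x disjoint_x] := exists_disjoint_translates ncG ord_eta cov_eta cC.
have /choice[k kP] a : exists k : R, 0 < k /\ forall A : set (borelType G),
    measurable A ->
    (mu ((fun t : G => (t * (x a)^-1)%g) @^-1` A) = k%:E * mu A)%E.
  by have [k k0 kP] := haar_right_translate hG haar_mu (x a)^-1%g; exists k.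
have k_gt0 a : 0 < k a by have [] := kP a.
have mu_rmul a := (kP a).2.
by do 3 eexists; exact: (fl1_base2_translates hG lcG haar_mu cC cover_C
  disjoint_x k_gt0 mu_rmul).
Qed.
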